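(* For every knot $K\subset S^3$, the complex $C_{\mathrm{univ}}(K)$ is homotopy equivalent to a chain complex of free shifted $A_{\mathrm{univ}}$-modules (i.e. direct sums of modules $A_{\mathrm{univ}}\{m\}$, $m\in\mathbb{Z}$), with differentials consisting only of integer multiples of powers of $2X-h$ (i.e. every matrix entry of every differential has the form $n(2X-h)^k$ with $n\in\mathbb{Z}$, $k\ge0$).
   Context: For a graded module $M$, $M\{m\}_n=M_{n-m}$ (shift in quantum degree). Let $R_{\mathrm{univ}}=\mathbb{Z}[h,t]$ and $A_{\mathrm{univ}}=\mathbb{Z}[h,t][X]/(X^2-hX-t)$, with $\deg X=\deg h=-2$, $\deg t=-4$, multiplication $m$, and comultiplication $\Delta(1)=1\otimes X+X\otimes1-h\,1\otimes1$, $\Delta(X)=X\otimes X+t\,1\otimes1$. Let $D$ be a diagram of an oriented knot $K$ with a base point away from crossings, with $n_+$ positive and $n_-$ negative crossings. Every crossing has a 0- and a 1-resolution; the orientation-compatible one is the 0-resolution for positive and the 1-resolution for negative crossings. To a complete resolution with $k+1$ circles associate $A_{\mathrm{univ}}\{1\}^{\otimes(k+1)}$ (tensor over $R_{\mathrm{univ}}$), an $A_{\mathrm{univ}}$-module via the factor of the circle containing the base point. To an edge of the cube of resolutions (one 0-resolution is changed to a 1-resolution) associate, with the usual signs making all squares anticommute, $m$ on the factors of two merging circles or $\Delta$ on the factor of a splitting circle. A resolution with $r$ 1-resolutions is placed in homological degree $r-n_-$ and shifted additionally by $\{r+n_+-2n_-\}$. The resulting complex of free graded $A_{\mathrm{univ}}$-modules,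 whose homotopy type depends only on $K$, is $C_{\mathrm{univ}}(K)$. *)

(* Defs.v *)
From HB Require Import structures.
From mathcomp Require Import all_boot all_order all_algebra.

Set Implicit Arguments.
Unset Strict Implicit.
Unset Printing Implicit Defensive.

Import GRing.Theory.
Local Open Scope ring_scope.

(** * The ground rings *)

(* Z[h,t], realised as Z[h][t]. *)
Notation Runiv := {poly {poly int}}.
Definition hR : Runiv := 'X%:P.
Definition tR : Runiv := 'X.

Definition Puniv : {poly Runiv} := 'X^2 - hR *: 'X - tR%:P.

Notation Auniv := {poly %/ Puniv}.

Definition XA : Auniv := in_qpoly Puniv 'X.
Definition hA : Auniv := hR%:A.
Definition tA : Auniv := tR%:A.

(* The coordinate of [a] on X^k in the Z[h,t]-basis 1, X. *)
Definition acoef (k : nat) (a : Auniv) : Runiv := (a : {poly Runiv})`_k.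

(* [{poly %/ p}] is R[X]/(p) only when p is monic of positive degree (it is
   R[X]/(X) otherwise), hence the check that [Puniv] is such. *)
Lemma size_XhXt : size (hR *: 'X + tR%:P : {poly Runiv}) = 2.
Proof.
have h0 : hR != 0 by rewrite polyC_eq0 polyX_eq0.
have hX : size (hR *: 'X : {poly Runiv}) = 2.
  by rewrite size_scale ?size_polyX.
by rewrite size_polyDl hX //; apply: leq_ltn_trans (size_polyC_leq1 _) _.
Qed.

Lemma PunivE : Puniv = 'X^2 - (hR *: 'X + tR%:P).
Proof. by rewrite /Puniv opprD addrA. Qed.

Lemma size_Puniv : size Puniv = 3.
Proof. by rewrite PunivE size_polyDl ?size_polyXn // size_polyN size_XhXt. Qed.

Lemma Puniv_monic : Puniv \is monic.
Proof.
rewrite monicE PunivE lead_coefDl ?lead_coefXn //.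
by rewrite size_polyN size_XhXt size_polyXn.
Qed.

Lemma mk_monic_Puniv : mk_monic Puniv = Puniv.
Proof. by rewrite /mk_monic size_Puniv Puniv_monic. Qed.

Lemma val_XA : XA = 'X :> {poly Runiv}.
Proof. by apply: qpolyXE; rewrite ?size_Puniv ?Puniv_monic. Qed.

Lemma XA_sqr : XA ^+ 2 = hA * XA + tA.
Proof.
have P0 : in_qpoly Puniv Puniv = 0.
  by apply/val_inj; rewrite /= mk_monic_Puniv Pdiv.RingMonic.rmodpp ?Puniv_monic.
have PE : 'X^2 = Puniv + (hR *: 'X + tR *: 1).
  by rewrite PunivE alg_polyC subrK.
rewrite /hA mulr_algl /tA /XA -(in_qpoly1 Puniv) -!linearZ -linearD /=.
by rewrite -rmorphXn /= PE linearD /= P0 add0r.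
Qed.

Lemma AunivE (a : Auniv) : a = (acoef 0 a)%:A + (acoef 1 a)%:A * XA.
Proof.
apply/val_inj/polyP => i; have := val_XA; move: XA => Y YX; rewrite mulr_algl /=.
have := size_npoly a; rewrite [in X in (_ <= X)%N]mk_monic_Puniv size_Puniv => sa.
rewrite YX coefD !coefZ coefC coefX /acoef.
case: i => [|[|i]] /=; rewrite ?mulr1 ?mulr0 ?addr0 ?add0r //.
by rewrite nth_default // (leq_trans sa).
Qed.

(** * Grading: h and X in degree -2, t in degree -4 *)

(* [p`_j`_i] is the coefficient of h^i t^j. *)
Definition Rhomog (q : int) (p : Runiv) : Prop :=
  forall i j : nat, p`_j`_i != 0 -> q = - (2 * i + 4 * j)%N%:Z.

Definition Ahomog (q : int) (a : Auniv) : Prop :=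
  Rhomog q (acoef 0 a) /\ Rhomog (q + 2) (acoef 1 a).

(** * Cochain complexes of graded modules *)

Record gcomplex := GComplex {
  cmod :> int -> lmodType Auniv;
  homog : forall i, int -> cmod i -> Prop;
  cdiff : forall i, cmod i -> cmod (i + 1)
}.
Arguments homog : clear implicits.
Arguments cdiff : clear implicits.

Definition is_complex (C : gcomplex) : Prop :=
  [/\ forall i, linear (cdiff C i),
      forall i q x, homog C i q x -> homog C (i + 1) q (cdiff C i x)
    & forall i x, cdiff C (i + 1) (cdiff C i x) = 0].

Record chain_map (C C' : gcomplex) := ChainMap {
  cmap :> forall i, {linear C i -> C' i};
  cmap_homog : forall i q x, homog C i q x -> homog C' i q (cmap i x);
  cmap_comm : forall i x, cmap (i + 1) (cdiff C i x) = cdiff C' i (cmap i x)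
}.

(* The homotopy s lowers the homological degree by one; every integer being of
   the form i + 1, the identity f - g = s d + d s is stated in degree i + 1. *)
Definition homotopic (C C' : gcomplex) (f g : forall i, C i -> C' i) : Prop :=
  exists s : forall i, {linear C (i + 1) -> C' i},
    (forall i q x, homog C (i + 1) q x -> homog C' i q (s i x)) /\
    (forall i x, f (i + 1) x - g (i + 1) x =
                 s (i + 1) (cdiff C (i + 1) x) + cdiff C' i (s i x)).

Definition homotopy_equivalent (C C' : gcomplex) : Prop :=
  exists (f : chain_map C C') (g : chain_map C' C),
    @homotopic C C (fun i x => g i (f i x)) (fun i x => x) /\
    @homotopic C' C' (fun i x => f i (g i x)) (fun i x => x).

(* In homological degree i, the direct sum of the A{sh i k} for k < rk i; since
   M{m}_n = M_(n-m), an element of A of degree q - m has degree q in A{m}. *)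
Definition free_complex (rk : int -> nat) (sh : forall i, 'I_(rk i) -> int)
    (M : forall i, 'M[Auniv]_(rk (i + 1), rk i)) : gcomplex :=
  {| cmod i := 'cV[Auniv]_(rk i) : lmodType Auniv;
     homog i q x := forall k, Ahomog (q - sh i k) (x k 0);
     cdiff i x := M i *m x |}.

(** * Knot diagrams *)

(* The classes of the equivalence relation generated by a list of pairs. *)
Definition glue_class (T : finType) (l : seq (T * T)) (x : T) : {set T} :=
  [set y | connect [rel a b | ((a, b) \in l) || ((b, a) \in l)] x y].

Definition glue_classes (T : finType) (l : seq (T * T)) : {set {set T}} :=
  [set glue_class l x | x in T].

(* Pointed oriented knot diagrams, as signed Gauss codes. Starting from the base
   point and following the orientation, one meets the crossings n.*2 times;
   [pass (c, true)] and [pass (c, false)] are the times at which crossing c is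
   traversed along its upper, resp. lower strand. The crossings and the base
   point cut the knot into n.*2.+1 arcs: passage p leads from arc p to arc p.+1,
   and the base point separates arc n.*2 from arc 0. *)
Record gauss_code := GaussCode {
  ncross : nat;
  pass : 'I_ncross * bool -> 'I_(ncross.*2);
  pass_inj : injective pass;
  is_pos : 'I_ncross -> bool
}.

Section Diagram.
Variable D : gauss_code.
Local Notation n := (ncross D).

Definition darc := 'I_(n.*2).+1.
Definition arc_in (c : 'I_n) (over : bool) : darc := inord (pass (c, over)).
Definition arc_out (c : 'I_n) (over : bool) : darc := inord (pass (c, over)).+1.

(* The sides of the arcs: [true] is the left one. At a positive crossing, drawn
   with the upper strand going from SW to NE and the lower one from SE to NW,
   the four pairs below are the two sides of the N, W, S and E regions. A
   negative crossing is the mirror image, which exchanges left and right. *)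
Definition crossing_sides (c : 'I_n) : seq ((darc * bool) * (darc * bool)) :=
  let l := is_pos c in
  [:: ((arc_out c true, l), (arc_out c false, ~~ l));
      ((arc_in c true, l), (arc_out c false, l));
      ((arc_in c true, ~~ l), (arc_in c false, l));
      ((arc_out c true, ~~ l), (arc_in c false, ~~ l))].

Definition regions : {set {set (darc * bool)}} :=
  glue_classes ([seq ((ord0, b), (ord_max, b)) | b <- [:: true; false]]
           ++ flatten [seq crossing_sides c | c <- enum 'I_n]).

(* The 4-valent graph of the code, with n vertices and 2n edges, embeds in the
   sphere compatibly with the crossings iff V - E + F = 2. (For n = 0 the same
   formula holds with the base point as vertex.) *)
Definition planar : bool := #|regions| == n.+2.

Definition npos : nat := #|[set c : 'I_n | is_pos c]|.
Definition nneg : nat := #|[set c : 'I_n | ~~ is_pos c]|.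

(** * The cube of resolutions *)

(* A complete resolution is given by the set of its 1-resolved crossings. *)
Definition resolution := {set 'I_n}.

Definition oriented_at (v : resolution) (c : 'I_n) : bool :=
  if is_pos c then c \notin v else c \in v.

Definition smoothing (v : resolution) (c : 'I_n) : seq (darc * darc) :=
  if oriented_at v c
  then [:: (arc_in c true, arc_out c false); (arc_in c false, arc_out c true)]
  else [:: (arc_in c true, arc_in c false); (arc_out c true, arc_out c false)].

Definition gluing (v : resolution) : seq (darc * darc) :=
  (ord0, ord_max) :: flatten [seq smoothing v c | c <- enum 'I_n].

(* A circle is identified with the set of arcs it consists of. *)
Definition circles (v : resolution) : {set {set darc}} := glue_classes (gluing v).

Definition base_circle (v : resolution) : {set darc} := glue_class (gluing v) ord0.

(* The tensor power of A over Z[h,t] indexed by [circles v] is free on the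
   labellings of the circles by 1 or X; a labelling is given by the set T of the
   circles labelled X. In homological degree i, the labelled resolutions (v, T)
   with #|v| - n_- = i form a basis over Z[h,t]. *)
Definition lres := (resolution * {set {set darc}})%type.

Definition lres_at (i : int) (s : lres) : bool :=
  (s.2 \subset circles s.1) && (#|s.1|%:Z - nneg%:Z == i).

Definition gen (i : int) := {s : lres | lres_at i s}.

(* Each factor A{1} contributes 1 for the label 1 and -1 for the label X. *)
Definition qdeg (s : lres) : int :=
  (#|circles s.1 :\: s.2|%:Z - #|s.2|%:Z) + (#|s.1|%:Z + npos%:Z - 2 * nneg%:Z).

Definition Cmod (i : int) := {ffun gen i -> Runiv}.
HB.instance Definition _ i := GRing.Zmodule.on (Cmod i).

Definition Chomog (i q : int) (x : Cmod i) : Prop :=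
  forall s : gen i, Rhomog (q - qdeg (val s)) (x s).

(** ** The action of A on the factor of the base circle *)

Definition base_label (s : lres) : bool := base_circle s.1 \in s.2.

Definition set_base (s : lres) (b : bool) : lres :=
  (s.1, if b then base_circle s.1 |: s.2 else s.2 :\ base_circle s.1).

Lemma set_base_at i s b : lres_at i s -> lres_at i (set_base s b).
Proof.
case/andP=> sT sv; rewrite /lres_at /= sv andbT.
case: b; last exact: subset_trans (subsetDl _ _) sT.
by rewrite subUset sub1set sT andbT; apply: imset_f.
Qed.

Definition gen_base i (s : gen i) (b : bool) : gen i :=
  Sub (set_base (val s) b) (set_base_at b (valP s)).

Lemma base_label_set s b : base_label (set_base s b) = b.
Proof. by rewrite /base_label; case: b; rewrite /= !inE eqxx. Qed.

Lemma set_base_set s b b' : set_base (set_base s b) b' = set_base s b'.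
Proof.
rewrite /set_base /=; congr (_, _).
by case: b b' => [] []; apply/setP => C; rewrite !inE; case: eqP.
Qed.

Lemma set_base_id s : set_base s (base_label s) = s.
Proof.
case: s => v T; rewrite /set_base /base_label /=; congr (_, _).
by case: ifP => bT; apply/setP => C; rewrite !inE; case: eqP => // ->.
Qed.

(* The coefficient of [a] times the labelled resolution with base label X^k at
   the one with base label X^j is the X^j-coordinate of a * X^k. *)
Definition act_fun i (a : Auniv) (x : Cmod i) : Cmod i :=
  [ffun s => \sum_(k : bool)
     acoef (base_label (val s)) (a * XA ^+ k) * x (gen_base s k)].

Lemma acoefD k a b : acoef k (a + b) = acoef k a + acoef k b.
Proof. by rewrite /acoef linearD coefD. Qed.

Lemma acoefZ k (r : Runiv) (a : Auniv) : acoef k (r *: a) = r * acoef k a.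
Proof. by rewrite /acoef linearZ coefZ. Qed.

Lemma acoef_mul k (a b : Auniv) :
  acoef k (a * b) = \sum_(l : bool) acoef l b * acoef k (a * XA ^+ l).
Proof.
rewrite {1}[b]AunivE mulrDr acoefD big_bool /= addrC expr1 expr0.
by rewrite mulr1 mulr_algl mulr_algr -scalerAr !acoefZ.
Qed.

Lemma acoef_XA (j k : bool) : acoef j (XA ^+ k) = (j == k)%:R.
Proof.
case: k; rewrite ?expr1 ?expr0 /acoef.
  by rewrite val_XA coefX; case: j.
by rewrite -(in_qpoly1 Puniv) in_qpoly_small ?coef1 ?size_poly1
   ?size_mk_monic_gt1 //; case: j.
Qed.

Lemma act_funA i a b (x : Cmod i) : act_fun a (act_fun b x) = act_fun (a * b) x.
Proof.
apply/ffunP => s; rewrite !ffunE.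
under eq_bigr => k _ do rewrite ffunE big_distrr /=.
rewrite exchange_big /=; apply: eq_bigr => k _.
rewrite -mulrA acoef_mul big_distrl /=; apply: eq_bigr => l _.
rewrite base_label_set mulrA [acoef l _ * _]mulrC; congr (_ * x _).
by apply/val_inj; rewrite /= set_base_set.
Qed.

Lemma act_fun1 i : left_id 1 (@act_fun i).
Proof.
move=> x; apply/ffunP => s; rewrite ffunE.
rewrite (bigD1 (base_label (val s))) //= big1 ?addr0 => [|k kb].
  rewrite mul1r acoef_XA eqxx mul1r; congr (x _).
  by apply/val_inj; rewrite /= set_base_id.
by rewrite mul1r acoef_XA eq_sym (negbTE kb) mul0r.
Qed.

Lemma act_funDr i : right_distributive (@act_fun i) +%R.
Proof.
move=> a x y; apply/ffunP => s; rewrite !ffunE -big_split /=.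
by apply: eq_bigr => k _; rewrite ffunE mulrDr.
Qed.

Lemma act_funDl i (x : Cmod i) : {morph (@act_fun i)^~ x : a b / a + b}.
Proof.
move=> a b; apply/ffunP => s; rewrite !ffunE -big_split /=.
by apply: eq_bigr => k _; rewrite mulrDl acoefD mulrDl.
Qed.

HB.instance Definition _ i := GRing.Zmodule_isLmodule.Build Auniv (Cmod i)
  (@act_funA i) (@act_fun1 i) (@act_funDr i) (@act_funDl i).

(** ** The differential *)

(* Merging two circles, k of them labelled X, into one labelled X^k'. *)
Definition mul_coef (k k' : nat) : Runiv := acoef k' (XA ^+ k).

(* Splitting a circle labelled X^k into two, k' of them labelled X:
   1 |-> 1 (x) X + X (x) 1 - h 1 (x) 1  and  X |-> X (x) X + t 1 (x) 1. *)
Definition comul_coef (k k' : nat) : Runiv :=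
  match k, k' with
  | 0, 0 => - hR
  | 0, 1 => 1
  | 1, 0 => tR
  | 1, 2 => 1
  | _, _ => 0
  end.

(* The circles common to v and v' keep their labels. *)
Definition edge_coef (s s' : lres) : Runiv :=
  let: (v, T) := s in let: (v', T') := s' in
  let old := circles v :\: circles v' in
  let new := circles v' :\: circles v in
  if T :\: old == T' :\: new then
    match #|old|, #|new| with
    | 2, 1 => mul_coef #|T :&: old| #|T' :&: new|
    | 1, 2 => comul_coef #|T :&: old| #|T' :&: new|
    | _, _ => 0
    end
  else 0.

Definition cube_coef (s s' : lres) : Runiv :=
  \sum_(c | (c \notin s.1) && (s'.1 == c |: s.1))
    (-1) ^+ #|[set j in s.1 | (j < c)%N]| * edge_coef s s'.

Definition Cdiff (i : int) (x : Cmod i) : Cmod (i + 1) :=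
  [ffun s' => \sum_(s : gen i) x s * cube_coef (val s) (val s')].

Definition Cuniv : gcomplex :=
  {| cmod := Cmod : int -> lmodType Auniv; homog := Chomog; cdiff := Cdiff |}.

End Diagram.

Record knot_diagram := KnotDiagram {
  code :> gauss_code;
  code_planar : planar code
}.

(* Main.v *)
From HB Require Import structures.
Require Import Defs.
From mathcomp Require Import all_boot all_order all_algebra all_fingroup ring zify.

(* Write G = 2X - h, let X be the variable of the base circle and Y that of another circle. Then
   Z = Y - X satisfies Z^2 = - G Z, and in terms of Z the comultiplication is 1 |-> 1 (x) Z +
   Z (x) 1 + G and Z |-> Z (x) Z, so replacing Y by Z at every circle but the base circle, which
   is an A-linear change of basis of the cube of resolutions, leaves only matrix entries 0, 1, -1,
   G and -G; no Gaussian elimination is needed.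
   Everything is checked by evaluation: giving to every circle one of the roots X, h - X of
   Y^2 - hY - t in A (to the base circle, the root X) yields a jointly injective family of A-linear
   functionals, as the difference of the roots is not a zero divisor. On these functionals an edge
   of the cube acts by restriction of colourings followed by a factor 1 (merge) or G, - G (split),
   and the cube anticommutes. That every edge is a merge or a split uses planarity: the Euler
   characteristic forces the regions to have a checkerboard colouring, hence the two passages of a
   crossing have opposite parities, and reversing every other arc makes the circles of a
   resolution the cycles of a permutation, which a change of resolution multiplies by a
   transposition. *)

Set Implicit Arguments.
Unset Strict Implicit.
Unset Printing Implicit Defensive.
Import GRing.Theory.
Local Open Scope ring_scope.

(** * Parity of the passages *)

Lemma glue_class_refl (T : finType) (l : seq (T * T)) x : x \in glue_class l x.
Proof. by rewrite inE connect0. Qed.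

Lemma glue_class_eq (T : finType) (l : seq (T * T)) x y :
  (y \in glue_class l x) = (glue_class l x == glue_class l y).
Proof.
have sym : connect_sym [rel a b | ((a, b) \in l) || ((b, a) \in l)].
  by apply: sym_connect_sym => a b /=; rewrite orbC.
apply/idP/eqP => [|->]; last exact: glue_class_refl.
by rewrite inE => xy; apply/setP=> z; rewrite !inE (same_connect sym xy).
Qed.

Lemma glue_class_pair (T : finType) (l : seq (T * T)) x y :
  (x, y) \in l -> glue_class l x = glue_class l y.
Proof.
by move=> xy; apply/eqP; rewrite -glue_class_eq inE connect1 //= xy.
Qed.

Section Parity.
Variable D : gauss_code.
Local Notation n := (ncross D).

Lemma pass_onto (p : 'I_(n.*2)) : exists c o, @pass D (c, o) = p.
Proof.
have /(_ p) : forall p, p \in codom (@pass D).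
  apply: inj_card_onto; first exact: pass_inj.
  by rewrite card_prod card_bool !card_ord muln2.
by case/codomP=> -[c o] ->; exists c, o.
Qed.

Lemma val_arc_in c o : @arc_in D c o = pass (c, o) :> nat.
Proof. by rewrite inordK // ltnS ltnW. Qed.

Lemma val_arc_out c o : @arc_out D c o = (pass (c, o)).+1 :> nat.
Proof. by rewrite inordK // ltnS. Qed.

(** Induction along the knot from the base point: every time is the time of some passage, so each
    arc other than arc 0 is the outgoing arc of a passage. *)
Lemma arc_ind (P : darc D -> Prop) :
  P ord0 -> (forall c o, P (arc_in c o) -> P (arc_out c o)) -> forall a, P a.
Proof.
move=> P0 PS [p]; elim: p => [|p IHp] p2n.
  by rewrite (_ : Ordinal _ = ord0) //; apply: val_inj.
have [c [o cop]] := pass_onto (Ordinal (p2n : (p < n.*2)%N)).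
have -> : Ordinal p2n = arc_out c o.
  by apply: val_inj; rewrite /= val_arc_out cop.
apply: PS; rewrite (_ : arc_in c o = Ordinal (ltnW p2n : (p < n.*2.+1)%N)) //.
by apply: val_inj; rewrite /= val_arc_in cop.
Qed.

Definition side_gluing : seq ((darc D * bool) * (darc D * bool)) :=
  [seq ((ord0, b), (ord_max, b)) | b <- [:: true; false]]
    ++ flatten [seq crossing_sides c | c <- enum 'I_n].

(* The colourings of the sides which descend to the regions. *)
Definition side_coloring (f : darc D -> bool -> bool) : Prop :=
  forall c (l := is_pos c), [/\ f (arc_out c true) l = f (arc_out c false) (~~ l),
   f (arc_in c true) l = f (arc_out c false) l,
   f (arc_in c true) (~~ l) = f (arc_in c false) l
   & f (arc_out c true) (~~ l) = f (arc_in c false) (~~ l)].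

Definition region_coloring (S : {set {set darc D * bool}}) a b :=
  glue_class side_gluing (a, b) \in S.

Lemma region_coloringP S : side_coloring (region_coloring S).
Proof.
move=> c l; rewrite /region_coloring.
have sub a b a' b' : ((a, b), (a', b')) \in crossing_sides c ->
    (glue_class side_gluing (a, b) \in S) = (glue_class side_gluing (a', b') \in S).
  move=> pq; congr (_ \in S); apply: glue_class_pair; rewrite mem_cat; apply/orP; right.
  by apply/flattenP; exists (crossing_sides c); rewrite // map_f // mem_enum.
by split; apply: sub; rewrite /crossing_sides !inE eqxx ?orbT.
Qed.

Definition arc_jump (f : darc D -> bool -> bool) a := f a true (+) f a false.

Lemma arc_jumpE f a b : arc_jump f a = f a b (+) f a (~~ b).
Proof. by case: b; rewrite // addbC. Qed.

(** Walking once around the crossing meets its four regions cyclically, so the changes of colour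
    across the four arcs sum to zero modulo 2. *)
Lemma side_coloring_jump f c : side_coloring f ->
  arc_jump f (arc_in c true) (+) arc_jump f (arc_out c true) =
  arc_jump f (arc_in c false) (+) arc_jump f (arc_out c false).
Proof.
case/(_ c) => h1 h2 h3 h4; rewrite !(arc_jumpE _ _ (is_pos c)) h1 h2 h3 h4.
by do 4!case: (f _ _).
Qed.

(** The jumps carry the colour across each arc, and the regions at a crossing carry it from incoming
    to outgoing arcs; along the knot this reaches every arc. *)
Lemma side_coloring_ext f f' : side_coloring f -> side_coloring f' ->
  f ord0 true = f' ord0 true -> arc_jump f =1 arc_jump f' -> forall a, f a =1 f' a.
Proof.
move=> fP fP' f0 ff'.
have eqt b a : f a b = f' a b -> forall b', f a b' = f' a b'.
  move=> e b'; have := ff' a; rewrite !(arc_jumpE _ _ b) e => /addbI.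
  by case: b b' e => [] [].
apply: arc_ind => [|c o IH] b; first exact: (eqt true).
apply: (eqt (is_pos c)); have [h1 h2 h3 h4] := fP c; have [k1 k2 k3 k4] := fP' c.
have e : f (arc_out c false) =1 f' (arc_out c false).
  apply: (eqt (is_pos c)); rewrite -h2 -k2; case: o IH => [|IH]; first exact.
  by apply: (eqt (~~ is_pos c)); rewrite h3 k3.
by case: o {IH}; rewrite // h1 k1.
Qed.

(** These are n + 2 bits: a colour and a jump at arc 0, and at each crossing the change of jump
    along the upper strand, which equals the one along the lower strand by [side_coloring_jump]. *)
Definition coloring_code (S : {set {set darc D * bool}}) : bool * bool * {ffun 'I_n -> bool} :=
  let f := region_coloring S in
  (f ord0 true, arc_jump f ord0,
   [ffun c => arc_jump f (arc_in c true) (+) arc_jump f (arc_out c true)]).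

(** The jump at arc 0 and its changes at the crossings give all jumps along the knot;
    [side_coloring_ext] then recovers the colouring. *)
Lemma coloring_code_inj : {in powerset (regions D) &, injective coloring_code}.
Proof.
move=> S S' /[!inE] Sr Sr' [S0 j0 /ffunP js].
have SP := region_coloringP S; have SP' := region_coloringP S'.
have eqS : forall a, region_coloring S a =1 region_coloring S' a.
  apply: side_coloring_ext => //; apply: arc_ind => // c o IH.
  have := js c; rewrite !ffunE => e; case: o IH => IH.
    by move: e; rewrite IH => /addbI.
  by move: e; rewrite !side_coloring_jump // IH => /addbI.
apply/setP => x; apply/idP/idP => xS.
  by have /imsetP[[a b] _ xE] := subsetP Sr _ xS; move: (eqS a b) xS; rewrite xE /region_coloring => <-.
by have /imsetP[[a b] _ xE] := subsetP Sr' _ xS; move: (eqS a b) xS; rewrite xE /region_coloring => <-.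
Qed.

Hypothesis Dplanar : planar D.

(** By planarity there are n + 2 regions, hence as many colourings of them as codes. The injection
    is thus onto, and the code with jump 1 at arc 0 and no change of jump at any crossing is
    attained. *)
Lemma checkerboard : exists2 f, side_coloring f & forall a b, f a (~~ b) = ~~ f a b.
Proof.
have : (false, true, [ffun _ => false]) \in coloring_code @: powerset (regions D).
  suff -> : coloring_code @: powerset (regions D) = setT by rewrite inE.
  apply/eqP; rewrite eqEcard subsetT cardsT card_in_imset; last exact: coloring_code_inj.
  by rewrite card_powerset (eqP Dplanar) !card_prod card_ffun !card_bool card_ord !expnS mulnA /= leqnn.
case/imsetP=> S _ [S0 j0 /ffunP js]; exists (region_coloring S); first exact: region_coloringP.
have j1 : forall a, arc_jump (region_coloring S) a.
  apply: arc_ind => [|c o IH]; first by rewrite -j0.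
  have := js c; rewrite !ffunE; case: o IH => IH.
    by rewrite IH; case: arc_jump.
  by rewrite side_coloring_jump ?IH; [case: arc_jump|exact: region_coloringP].
by move=> a b; have := j1 a; rewrite (arc_jumpE _ _ b); do 2!case: region_coloring.
Qed.

(** Gauss's parity condition. In a checkerboard colouring the left side changes colour at each
    passage, so it records the parity of the arc. The two arcs entering a crossing have opposite
    left colours, as the left side of one and the right side of the other border the same region. *)
Lemma pass_parity c o : odd (pass (c, ~~ o)) = ~~ odd (@pass D (c, o)).
Proof.
have [f fP fN] := checkerboard; have fF a : f a false = ~~ f a true := fN a true.
have f1 : forall a, f a true = f ord0 true (+) odd a.
  apply: arc_ind => [|d p]; first by rewrite addbF.
  have [h1 h2 h3 h4] := fP d; rewrite val_arc_in val_arc_out /= addbN => <-.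
  by move: h1 h2 h3 h4; case: p; case: is_pos; rewrite /= ?fF; do 4?case: (f _ true).
have [_ _ h3 _] := fP c.
have : f (arc_in c (~~ o)) true = ~~ f (arc_in c o) true.
  by move: h3; case: o; case: is_pos; rewrite /= ?fF;
    move: (f (arc_in c true) true) (f (arc_in c false) true) => [] [].
by rewrite (f1 (arc_in c (~~ o))) (f1 (arc_in c o)) !val_arc_in; case: (f _ _) => /= [/negb_inj|].
Qed.
End Parity.

(** * Circles as cycles of a permutation *)

Section PermOrbits.
Local Open Scope group_scope.
Variable T : finType.
Implicit Types (s : {perm T}) (x y z : T) (phi : T -> bool).

Definition invariant_under s phi := [forall z, phi (s z) == phi z].

Lemma invariant_porbit s phi x y :
  invariant_under s phi -> y \in porbit s x -> phi y = phi x.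
Proof.
move=> /forallP inv /porbitP[i ->]; elim: i => [|i IH]; first by rewrite perm1.
by rewrite expgSr permM (eqP (inv _)).
Qed.

Lemma invariant_tperm s x y phi : phi x = phi y ->
  invariant_under (tperm x y * s) phi = invariant_under s phi.
Proof.
move=> e; have pt z : phi (tperm x y z) = phi z by case: tpermP => // ->.
apply/forallP/forallP => inv z; last by rewrite permM (eqP (inv _)) pt.
by have := inv (tperm x y z); rewrite permM tpermK pt.
Qed.

Lemma porbit_perm1 s x : porbit s (s x) = porbit s x.
Proof. exact: (porbit_perm s 1). Qed.

Lemma porbit_tperm_out s x y z : x \notin porbit s z -> y \notin porbit s z ->
  porbit (tperm x y * s) z = porbit s z.
Proof.
move=> xz yz; have E n : ((tperm x y * s) ^+ n) z = (s ^+ n) z.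
  elim: n => // n IH; rewrite !expgSr !permM IH tpermD //.
    by apply: contraNneq xz => ->; rewrite mem_porbit.
  by apply: contraNneq yz => ->; rewrite mem_porbit.
by apply/setP=> w; apply/porbitP/porbitP => -[n ->]; exists n.
Qed.

(** Otherwise multiplying twice by the transposition would lower the number of cycles twice,
    although it restores [s]. *)
Lemma porbit_tperm_merge s x y : y \notin porbit s x -> y \in porbit (tperm x y * s) x.
Proof.
move=> yx; apply: contraT => yx'.
have := porbits_mul_tperm s x y; have := porbits_mul_tperm (tperm x y * s) x y.
rewrite /= tpermKg ![x \in _]porbit_sym yx yx'.
have -> : x != y by apply: contraNneq yx => ->; rewrite porbit_id.
by rewrite !addn1 !addn2 => -[<-] /eqP; rewrite !eqSS eqn_leq ltnNge leqnSn.
Qed.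

(** The same count: otherwise the number of cycles would rise twice. *)
Lemma porbit_tperm_split s x y : x != y -> y \in porbit s x ->
  y \notin porbit (tperm x y * s) x.
Proof.
move=> xy yx; apply/negP => yx'.
have := porbits_mul_tperm s x y; have := porbits_mul_tperm (tperm x y * s) x y.
rewrite /= tpermKg ![x \in _]porbit_sym yx yx' xy !addn0 !addn1 => -> /eqP.
by rewrite -[X in X == _]addn0 -addn2 eqn_add2l.
Qed.

Section Merge.
Variables (s : {perm T}) (x y : T).
Hypothesis yx : y \notin porbit s x.
Let t := (tperm x y * s)%g.

Let sub_porbit z w : w \in porbit s z -> porbit t w = porbit t z.
Proof.
have step a : porbit t (s a) = porbit t a.
  have -> : s a = t (tperm x y a) by rewrite permM tpermK.
  rewrite porbit_perm1; case: tpermP => // ->; apply/eqP; rewrite eq_porbit_mem ?porbit_tperm_merge //.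
  by rewrite porbit_sym porbit_tperm_merge.
by case/porbitP=> n ->; elim: n => [|n IH]; rewrite ?perm1 // expgSr permM step.
Qed.

Let tyx : porbit t y = porbit t x.
Proof. by apply/eqP; rewrite eq_porbit_mem porbit_tperm_merge. Qed.

(** A common cycle through [x] or [y] would be the cycle of that point for both permutations; but
    the cycle for [t] contains both points, and no cycle of [s] does. *)
Let porbit_neq C : C \in porbits s -> C \in porbits t -> (x \notin C) && (y \notin C).
Proof.
case/imsetP=> a _ -> /imsetP[b _ eab]; have [xa|xa] /= := boolP (x \in porbit s a).
  case/negP: yx; have /eqP -> : porbit s x == porbit s a by rewrite eq_porbit_mem.
  move: xa; rewrite eab -!eq_porbit_mem => /eqP <-; exact/eqP.
apply/negP => ya; case/negP: yx; rewrite porbit_sym.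
have /eqP -> : porbit s y == porbit s a by rewrite eq_porbit_mem.
by move: ya; rewrite eab -!eq_porbit_mem tyx.
Qed.

Lemma porbits_merge_old : porbits s :\: porbits t = [set porbit s x; porbit s y].
Proof.
apply/setP => C; rewrite !inE; apply/andP/orP => [[Ct /imsetP[z _ Cz]]|Cxy].
  apply/orP; move: Ct; rewrite Cz; apply: contraR; rewrite negb_or => /andP[zx zy].
  by rewrite -(porbit_tperm_out (x := x) (y := y)) ?imset_f // porbit_sym -eq_porbit_mem.
have Cs : C \in porbits s by case: Cxy => /eqP ->; rewrite imset_f.
split=> //; apply/negP => /(porbit_neq Cs).
by case: Cxy => /eqP ->; rewrite porbit_id ?andbF.
Qed.

Lemma porbits_merge_new : porbits t :\: porbits s = [set porbit t x].
Proof.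
apply/setP => C; rewrite !inE; apply/andP/eqP => [[Cs /imsetP[z _ Cz]]|->].
  have [zx|zx] := boolP (z \in porbit s x); first by rewrite Cz (sub_porbit zx).
  have [zy|zy] := boolP (z \in porbit s y); first by rewrite Cz (sub_porbit zy).
  by case/negP: Cs; rewrite Cz porbit_tperm_out ?imset_f // porbit_sym.
have Ct : porbit t x \in porbits t by rewrite imset_f.
by split=> //; apply/negP => /porbit_neq /(_ Ct); rewrite porbit_id.
Qed.
End Merge.

Section Split.
Variables (s : {perm T}) (x y : T).
Hypotheses (xy : x != y) (yx : y \in porbit s x).
Let t := (tperm x y * s)%g.
(** A split is a merge read backwards. *)
Let ts : s = (tperm x y * t)%g. Proof. by rewrite tpermKg. Qed.

Lemma porbits_split_old : porbits s :\: porbits t = [set porbit s x].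
Proof. by rewrite [in LHS]ts porbits_merge_new ?porbit_tperm_split // -ts. Qed.

Lemma porbits_split_new : porbits t :\: porbits s = [set porbit t x; porbit t y].
Proof. by rewrite [in LHS]ts porbits_merge_old // porbit_tperm_split. Qed.
End Split.

Lemma glue_class_porbit (l : seq (T * T)) s :
  (forall p, p \in l -> p.2 \in porbit s p.1) ->
  (forall a, ((a, s a) \in l) || ((s a, a) \in l)) -> glue_class l =1 porbit s.
Proof.
move=> lP sP x; apply/setP => y; apply/idP/idP.
  have lE a b : (a, b) \in l -> porbit s b = porbit s a.
    by move=> ab; apply/eqP; rewrite eq_porbit_mem; apply: (lP (a, b)).
  rewrite inE => /connectP[p + ->] {y}; elim: p x => [|z p IH] x /=.
    by rewrite porbit_id.
  by case/andP=> /orP[] /lE e /IH; rewrite e.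
case/porbitP => i ->; rewrite glue_class_eq; elim: i => [|i]; first by rewrite perm1.
move=> /eqP ->; rewrite expgSr permM; set a := (s ^+ i)%g x.
by case/orP: (sP a) => /glue_class_pair ->.
Qed.
End PermOrbits.

(* Planarity allows the arcs to be oriented alternately (the arc p is reversed when p is odd),
   every smoothing being compatible with these orientations. *)
Section CirclePermutation.
Variable D : gauss_code.
Hypothesis Dplanar : planar D.
Local Notation n := (ncross D).

Definition arc c o (b : bool) : darc D := if b then arc_out c o else arc_in c o.

Lemma val_arc c o b : arc c o b = (pass (c, o) + b)%N :> nat.
Proof. by case: b; rewrite /arc ?val_arc_in ?val_arc_out ?addn0 ?addn1. Qed.

(** With the odd arcs reversed, every arc but the last ends at an even passage, and the next arc of
    its circle starts at the odd passage of the same crossing. The default [ord0] serves the last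
    arc, which runs through the base point. *)
Definition circle_next (v : resolution D) (a : darc D) : darc D :=
  if [pick co | (pass co + odd a == a)%N] is Some (c, o)
  then arc c (~~ o) (oriented_at v c (+) odd a) else ord0.

Lemma circle_next_arc v c o b : ~~ odd (pass (c, o)) ->
  circle_next v (arc c o b) = arc c (~~ o) (oriented_at v c (+) b).
Proof.
move=> ev; have ob : odd (arc c o b) = b by rewrite val_arc oddD (negbTE ev) oddb.
rewrite /circle_next ob; case: pickP => [[c' o'] /eqP|/(_ (c, o))].
  by rewrite val_arc => /addIn/val_inj/pass_inj [-> ->].
by rewrite val_arc eqxx.
Qed.

Lemma circle_next_max v : circle_next v ord_max = ord0.
Proof.
rewrite /circle_next /= odd_double; case: pickP => // -[c o]; rewrite addn0 => /eqP e.
by have := ltn_ord (pass (c, o)); rewrite e ltnn.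
Qed.

Variant arc_spec : darc D -> Prop :=
  | ArcMax : arc_spec ord_max
  | ArcCross c o b of ~~ odd (@pass D (c, o)) : arc_spec (arc c o b).

Lemma arcP a : arc_spec a.
Proof.
have [->|a_max] := eqVneq a ord_max; first by constructor.
have a_lt : (a < n.*2)%N.
  by rewrite ltn_neqAle -ltnS ltn_ord andbT; apply: contra_neq a_max => e; apply: val_inj.
have q_lt : (a - odd a < n.*2)%N by apply: leq_ltn_trans a_lt; rewrite leq_subr.
have oa : (odd a <= a)%N by case: (val a) => // k; case: odd.
have [c [o co]] := pass_onto (Ordinal q_lt).
have -> : a = arc c o (odd a) by apply: val_inj; rewrite /= val_arc co /= subnK.
by constructor; rewrite co /= oddB // oddb addbb.
Qed.

(** Successors at crossings start at odd passages, which excludes arc 0, the successor of the last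
    arc. The parity of a successor tells whether it enters or leaves its passage, which then
    determines the crossing. *)
Lemma circle_next_inj v : injective (circle_next v).
Proof.
have od c o : ~~ odd (pass (c, o)) -> odd (@pass D (c, ~~ o)) by rewrite pass_parity.
move=> a a'; case: (arcP a) => [|c o b ev]; case: (arcP a') => [|c' o' b' ev'] //;
  rewrite ?circle_next_max ?circle_next_arc //.
- by move/(congr1 val); rewrite /= val_arc => /esym/eqP; rewrite addn_eq0 => /andP[/eqP e];
  have := od _ _ ev'; rewrite e.
- by move/(congr1 val); rewrite /= val_arc => /eqP; rewrite addn_eq0 => /andP[/eqP e];
  have := od _ _ ev; rewrite e.
move/(congr1 val); rewrite /= !val_arc => e.
have eb : oriented_at v c (+) b = oriented_at v c' (+) b'.
  by have := congr1 odd e; rewrite !oddD !od // !oddb => /addbI.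
by move: e; rewrite eb => /addIn/val_inj/pass_inj[ec /negb_inj ->]; move: eb; rewrite ec => /addbI ->.
Qed.

Definition circle_perm v : {perm darc D} := perm (@circle_next_inj v).

Definition even_strand c : bool := ~~ odd (@pass D (c, true)).
(** [cross_x] and [cross_y] are the two arcs that end at the crossing in the alternating
    orientation. *)
Definition cross_x c : darc D := arc c (even_strand c) false.
Definition cross_y c : darc D := arc c (even_strand c) true.

Lemma even_strandP c : ~~ odd (@pass D (c, even_strand c)).
Proof.
rewrite /even_strand; case e : (odd (pass (c, true))) => /=; last by rewrite e.
by have := pass_parity Dplanar c true; rewrite e => ->.
Qed.

Lemma even_strand_uniq c o : ~~ odd (@pass D (c, o)) -> o = even_strand c.
Proof.
rewrite /even_strand; case: o => [->|] //.
by have /= -> := pass_parity Dplanar c true; rewrite negbK => ->.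
Qed.

Lemma glue_class_circle v : glue_class (gluing v) =1 porbit (circle_perm v).
Proof.
have od c o : ~~ odd (pass (c, o)) -> odd (@pass D (c, ~~ o)) by rewrite pass_parity.
have sm c o b : ~~ odd (@pass D (c, o)) ->
    (arc c o b, circle_perm v (arc c o b)) \in smoothing v c
    \/ (circle_perm v (arc c o b), arc c o b) \in smoothing v c.
  move=> ev; rewrite permE circle_next_arc // /smoothing.
  by case: oriented_at; case: o {ev}; case: b; rewrite /arc /= !inE !eqxx ?orbT; auto.
have sm' c p : p \in smoothing v c -> exists b (a := arc c (even_strand c) b),
    p = (a, circle_perm v a) \/ p = (circle_perm v a, a).
  have E b : circle_perm v (arc c (even_strand c) b)
           = arc c (~~ even_strand c) (oriented_at v c (+) b).
    by rewrite permE circle_next_arc ?even_strandP.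
  move=> pc; suff [b pb] : exists b (a := arc c (even_strand c) b)
      (a' := arc c (~~ even_strand c) (oriented_at v c (+) b)), p = (a, a') \/ p = (a', a).
    by exists b; rewrite /= E.
  move: pc; rewrite /smoothing; move: (oriented_at v c) (even_strand c) => ov es.
  (* The witness describes the end of the pair on the even strand: true if it is the outgoing arc,
     false if it is the incoming one. *)
  by case: ov; rewrite !inE => /orP[] /eqP ->; case: es;
    [exists false|exists true|exists true|exists false
    |exists false|exists false|exists true|exists true];
    rewrite /arc /=; auto.
apply: glue_class_porbit => [p|a].
  rewrite inE => /orP[/eqP ->|/flattenP[l /mapP[c _ ->]]] /=.
    have <- : circle_perm v ord_max = ord0 by rewrite permE circle_next_max.
    by rewrite porbit_sym (mem_porbit _ 1).
  by case/sm' => b /= [] -> /=; rewrite ?(mem_porbit _ 1) // porbit_sym (mem_porbit _ 1).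
case: (arcP a) => [|c o b ev]; first by rewrite permE circle_next_max !inE eqxx orbT.
have sub p : p \in smoothing v c -> p \in gluing v.
  by move=> pc; rewrite inE; apply/orP; right; apply/flattenP;
    exists (smoothing v c); rewrite // map_f ?mem_enum.
by case: (sm c o b ev) => /sub ->; rewrite ?orbT.
Qed.

Lemma circles_porbits v : circles v = porbits (circle_perm v).
Proof. by apply: eq_imset; apply: glue_class_circle. Qed.

Lemma base_circle_porbit v : base_circle v = porbit (circle_perm v) ord0.
Proof. exact: glue_class_circle. Qed.

Lemma cross_neq c : cross_x c != cross_y c.
Proof. by rewrite -val_eqE /= !val_arc eqn_add2l. Qed.

Lemma oriented_at_add (v : resolution D) c d : c \notin v ->
  oriented_at (c |: v) d = (d == c) (+) oriented_at v d.
Proof.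
move=> cv; rewrite /oriented_at !inE; case: eqP => [->|_] //=.
by rewrite (negbTE cv); case: is_pos.
Qed.

Lemma arc_even_inj c c' o o' b b' : ~~ odd (@pass D (c, o)) -> ~~ odd (@pass D (c', o')) ->
  arc c o b = arc c' o' b' -> c = c'.
Proof.
move=> ev ev' /(congr1 val) /=; rewrite !val_arc => e.
have eb : b = b' by have := congr1 odd e; rewrite !oddD (negbTE ev) (negbTE ev') !oddb.
by move: e; rewrite eb => /addIn/val_inj/pass_inj[].
Qed.

(** Either resolution joins the two arcs ending at [c] to the two arcs starting there; changing it
    exchanges the two successors and affects no other arc. *)
Lemma circle_perm_add (v : resolution D) c : c \notin v ->
  circle_perm (c |: v) = (tperm (cross_x c) (cross_y c) * circle_perm v)%g.
Proof.
move=> cv; apply/permP => a; rewrite permM ![circle_perm _ _]permE.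
case: (arcP a) => [|d o b ev].
  have ev c' b : arc c' (even_strand c') b != ord_max.
    apply/eqP => /(congr1 (circle_next v)); rewrite circle_next_max circle_next_arc ?even_strandP //.
    move/(congr1 val); rewrite /= val_arc => /eqP; rewrite addn_eq0 => /andP[/eqP e].
    by have := even_strandP c'; rewrite -pass_parity ?e.
  by rewrite tpermD ?ev // !circle_next_max.
rewrite circle_next_arc // oriented_at_add //; have [dc|dc] /= := eqVneq d c.
  rewrite {d}dc in ev *; have oe := even_strand_uniq ev; rewrite oe in ev *.
  by case: b; rewrite ?tpermR ?tpermL circle_next_arc // ?addbN ?addNb // ?addbT ?addbF ?negbK.
rewrite tpermD ?circle_next_arc //; apply: contra_neq dc => /esym;
  by apply: arc_even_inj => //; apply: even_strandP.
Qed.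
End CirclePermutation.

(** * Merging and splitting labels *)

Lemma big_setU1_split (I : finType) (S : nmodType) (c : I) (P : pred {set I}) (F : {set I} -> S) :
  \sum_(J : {set I} | P J) F J =
  \sum_(J : {set I} | (c \notin J) && P J) F J +
  \sum_(J : {set I} | (c \notin J) && P (c |: J)) F (c |: J).
Proof.
rewrite (bigID (fun J : {set I} => c \notin J)) /=; congr (_ + _).
  by apply: eq_bigl => J; rewrite andbC.
rewrite (reindex_onto (fun J => c |: J) (fun J => J :\ c)) => [|J /andP[_]] /=.
  apply: eq_bigl => J; rewrite negbK setU11 andbT andbC; congr (_ && _).
  by apply/eqP/idP => [<-|/setU1K //]; rewrite !inE eqxx.
by rewrite negbK => /setD1K.
Qed.

Section FrobeniusCoefficients.
Variables (S : comNzRingType) (h t : S).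

(** Structure constants of S[Y]/(Y^2 - hY - t). The parameters are kept general to cover both Y,
    with [hA] and [tA], and Z = Y - X, with [- GA] and 0. *)
Definition frob_mul (k k' : nat) : S :=
  match k, k' with
  | 0, 0 | 1, 1 => 1
  | 2, 0 => t
  | 2, 1 => h
  | _, _ => 0
  end.

Definition frob_comul (k k' : nat) : S :=
  match k, k' with
  | 0, 0 => - h
  | 0, 1 | 1, 2 => 1
  | 1, 0 => t
  | _, _ => 0
  end.

Definition frob_edge (I : finType) (K K' T T' : {set I}) : S :=
  let old := K :\: K' in
  let new := K' :\: K in
  if T :\: old == T' :\: new then
    match #|old|, #|new| with
    | 2, 1 => frob_mul #|T :&: old| #|T' :&: new|
    | 1, 2 => frob_comul #|T :&: old| #|T' :&: new|
    | _, _ => 0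
    end
  else 0.

Variables (I : finType) (K K' : {set I}) (r : I -> S).
Local Notation old := (K :\: K').
Local Notation new := (K' :\: K).

(** The common circles keep their labels, so [T'] consists of [T :\: old] and an arbitrary set J of
    new circles. *)
Lemma sum_relabel (T : {set I}) (f : nat -> S) : T \subset K ->
  \sum_(T' : {set I}) (if T :\: old == T' :\: new then f #|T' :&: new| else 0) * \prod_(C in T') r C =
  \prod_(C in T :\: old) r C * \sum_(J : {set I} | J \subset new) f #|J| * \prod_(C in J) r C.
Proof.
move=> TK; rewrite (eq_bigr (fun T' => if T :\: old == T' :\: new
    then f #|T' :&: new| * \prod_(C in T') r C else 0)) => [|T' _]; last by case: ifP; rewrite ?mul0r.
rewrite -big_mkcond /= big_distrr /=.
have dT : [disjoint T :\: old & new].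
  by rewrite -setI_eq0; apply/eqP/setP=> C; rewrite !inE;
    case: (boolP (C \in T)) => [/(subsetP TK) ->|_]; rewrite /= ?andbF.
rewrite (reindex_onto (fun J => (T :\: old) :|: J) (fun T' => T' :&: new)) => [|T' /eqP ->].
  apply: eq_big => [J|J /andP[_ /eqP e]].
    apply/andP/idP => [[_ /eqP <-]|Jn]; first exact: subsetIr.
    have J1 : (T :\: old :|: J) :&: new = J.
      by rewrite setIUl (disjoint_setI0 dT) set0U; apply/setIidPl.
    split; rewrite ?J1 //; rewrite setDUl (setDidPl dT).
    by move: (Jn); rewrite -setD_eq0 => /eqP ->; rewrite setU0.
  have Jn : J \subset new by rewrite -e subsetIr.
  rewrite e mulrCA -bigU //=; last exact: disjointWr dT.
  by congr (_ * _); apply: eq_bigl => C; rewrite inE.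
by rewrite /= setUC setID.
Qed.

Lemma sum_subset1 (C : I) (f : nat -> S) :
  \sum_(J : {set I} | J \subset [set C]) f #|J| * \prod_(i in J) r i = f 0%N + f 1%N * r C.
Proof.
rewrite (eq_bigl (fun J => J \in powerset [set C])) => [|J]; last by rewrite inE.
rewrite powerset1 big_setU1 ?big_set1 /=; first by rewrite cards0 cards1 big_set0 mulr1.
by rewrite inE; apply/negP => /eqP/setP/(_ C); rewrite !inE eqxx.
Qed.

Lemma sum_subset2 (C C' : I) (f : nat -> S) : C != C' ->
  \sum_(J : {set I} | J \subset [set C; C']) f #|J| * \prod_(i in J) r i =
  f 0%N + f 1%N * (r C + r C') + f 2 * (r C * r C').
Proof.
move=> CC'; rewrite (big_setU1_split C) /=.
have e (J : {set I}) : (C \notin J) && (J \subset [set C; C']) = (J \subset [set C']).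
  apply/andP/idP => [[CJ] |JC]; first by rewrite -subDset; apply: subset_trans; rewrite subsetD1 subxx.
  split; last by apply: subset_trans JC _; rewrite subsetUr.
  by apply/negP => /(subsetP JC); rewrite inE (negbTE CC').
have e' (J : {set I}) : (C \notin J) && (C |: J \subset [set C; C']) = (J \subset [set C']).
  by rewrite -e; congr (_ && _); rewrite subUset sub1set !inE eqxx.
rewrite (eq_bigl _ _ e) (eq_bigl _ _ e') sum_subset1.
rewrite (eq_bigr (fun J : {set I} => r C * (f #|J|.+1 * \prod_(i in J) r i))) => [|J JC].
  by rewrite -big_distrr (sum_subset1 _ (fun k => f k.+1)) /=; ring.
have CJ : C \notin J by apply/negP => /(subsetP JC); rewrite inE (negbTE CC').
by rewrite cardsU1 CJ big_setU1 //= mulrCA.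
Qed.

(** Evaluation at a root of Y^2 - hY - t respects products; here the merging circles and the
    resulting one are evaluated at the same root. *)
Lemma frob_edge_merge C1 C2 C3 (T : {set I}) : T \subset K -> C1 != C2 ->
  old = [set C1; C2] -> new = [set C3] -> r C1 = r C3 -> r C2 = r C3 ->
  r C3 * r C3 = h * r C3 + t ->
  \sum_(T' : {set I}) frob_edge K K' T T' * \prod_(C in T') r C = \prod_(C in T) r C.
Proof.
move=> TK C12 oldE newE r1 r2 r3.
have cold : #|old| = 2 by rewrite oldE cards2 C12.
have cnew : #|new| = 1%N by rewrite newE cards1.
rewrite /frob_edge cold cnew sum_relabel // newE sum_subset1.
rewrite [RHS](big_setID old) /= mulrC; congr (_ * _).
rewrite (eq_bigr (fun => r C3)) => [|C]; last by rewrite oldE !inE => /andP[_ /orP[] /eqP ->].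
rewrite prodr_const; have : (#|T :&: old| <= 2)%N.
  by rewrite (leq_trans (subset_leq_card (subsetIr _ _))) // cold.
by case: #|_| => [|[|[|//]]] _ /=; rewrite ?expr0 ?expr1 ?expr2 ?r3; ring.
Qed.

(** The two equations on [w] say that the comultiplications of 1 and of Y, evaluated at the values
    of the new circles, are [w] times the values of 1 and of Y on the old circle. *)
Lemma frob_edge_split C1 C2 C3 (T : {set I}) w : T \subset K -> C1 != C2 ->
  old = [set C3] -> new = [set C1; C2] ->
  r C1 + r C2 - h = w -> r C1 * r C2 + t = w * r C3 ->
  \sum_(T' : {set I}) frob_edge K K' T T' * \prod_(C in T') r C = w * \prod_(C in T) r C.
Proof.
move=> TK C12 oldE newE w1 w2.
have cold : #|old| = 1%N by rewrite oldE cards1.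
have cnew : #|new| = 2 by rewrite newE cards2 C12.
rewrite /frob_edge cold cnew sum_relabel // newE sum_subset2 //.
rewrite [in RHS](big_setID old) /= [RHS]mulrA [RHS]mulrC; congr (_ * _).
rewrite (eq_bigr (fun => r C3)) => [|C]; last by rewrite oldE !inE => /andP[_ /eqP ->].
rewrite prodr_const; have : (#|T :&: old| <= 1)%N.
  by rewrite (leq_trans (subset_leq_card (subsetIr _ _))) // cold.
by case: #|_| => [|[|//]] _ /=; rewrite ?expr0 ?expr1 -?w2 -?w1; ring.
Qed.
End FrobeniusCoefficients.

(** * Joint injectivity of the evaluations *)

Section Vandermonde.
Variables (S : comNzRingType) (rho : bool -> S) (I : finType).
Hypothesis rho_reg : forall x, (rho true - rho false) * x = 0 -> x = 0.

(** The matrix of all evaluations is a tensor power of the Vandermonde matrix of the two roots;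
    applying the tensor power of its adjugate multiplies each [g T] by a power of the difference of
    the roots. *)
Lemma labels_eq0 (g : {set I} -> S) :
  (forall psi : {ffun I -> bool}, \sum_(T : {set I}) g T * \prod_(C in T) rho (psi C) = 0) ->
  forall T, g T = 0.
Proof.
move=> g0 T0; have regX n x : (rho true - rho false) ^+ n * x = 0 -> x = 0.
  by elim: n => [|n IH]; rewrite ?mul1r // exprS -mulrA => /rho_reg.
(* The adjugate: the sum over [b] of [adj l b] times the power [l'] of [rho b] is
   [rho true - rho false] if l = l' and 0 otherwise. *)
pose adj (l b : bool) : S := if l then (if b then 1 else -1) else (if b then - rho false else rho true).
apply: (regX #|I|).
transitivity (\sum_(psi : {ffun I -> bool}) \prod_C adj (C \in T0) (psi C) *
   \sum_(T : {set I}) g T * \prod_(C in T) rho (psi C)); last first.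
  by rewrite big1 // => psi _; rewrite g0 mulr0.
under eq_bigr => psi _ do rewrite big_distrr /=.
rewrite exchange_big /=.
under eq_bigr => T _.
  under eq_bigr => psi _ do rewrite mulrCA [X in _ * (_ * X)]big_mkcond -big_split /=.
  rewrite -big_distrr /= -(bigA_distr_bigA (fun C b =>
    adj (C \in T0) b * (if C \in T then rho b else 1))) /=.
  over.
rewrite (bigD1 T0) //= [X in _ = _ + X]big1 => [|T TT0].
  rewrite addr0 mulrC -prodr_const; congr (_ * _); apply: eq_big => // C _.
  by rewrite big_bool /adj; case: ifP => _ /=; ring.
have /existsP[C CT] : [exists C, (C \in T) != (C \in T0)].
  apply: contraR TT0; rewrite negb_exists => /forallP e.
  by apply/eqP/setP => C; apply/eqP; have := e C; rewrite negbK.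
rewrite (bigD1 C) //= big_bool /adj; move: CT; do 2!case: ifP => //= _; move=> _; rewrite /=; ring.
Qed.
End Vandermonde.

(** * The cube on colourings *)

Lemma invariant_tperm_eq (T : finType) (s : {perm T}) x y phi :
  invariant_under s phi -> invariant_under (tperm x y * s)%g phi -> phi x = phi y.
Proof.
move=> /forallP inv /forallP inv'; have := inv' x.
by rewrite permM tpermL (eqP (inv _)) => /eqP.
Qed.

(* Two consecutive edges with the same source and target split circles equally often. *)
Lemma split_count (S : comNzRingType) (u : S) (a b a' b' : bool) (k l l' m : nat) :
  (l + (~~ a).*2 = k + true)%N -> (m + (~~ b).*2 = l + true)%N ->
  (l' + (~~ a').*2 = k + true)%N -> (m + (~~ b').*2 = l' + true)%N ->
  (if a then u else 1) * (if b then u else 1) = (if a' then u else 1) * (if b' then u else 1).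
Proof.
case: a; case: b; case: a'; case: b' => /= h1 h2 h3 h4; rewrite ?mulr1 ?mul1r //;
  by exfalso; clear -h1 h2 h3 h4; lia.
Qed.

Section Cube.
Variables (D : gauss_code) (Dplanar : planar D).
Local Notation n := (ncross D).
Local Notation perm_of v := (circle_perm Dplanar v).
Variable S : comNzRingType.

Definition cube_sign (v : resolution D) (c : 'I_n) : S := (-1) ^+ #|[set j in v | (j < c)%N]|.

Definition frob_cube (h t : S) (s s' : lres D) : S :=
  \sum_(c | (c \notin s.1) && (s'.1 == c |: s.1))
    cube_sign s.1 c * frob_edge h t (circles s.1) (circles s'.1) s.2 s'.2.

Definition circle_color (phi : darc D -> bool) (C : {set darc D}) := [exists x in C, phi x].

Lemma circle_color_porbit v phi x :
  invariant_under (perm_of v) phi -> circle_color phi (porbit (perm_of v) x) = phi x.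
Proof.
move=> inv; apply/exists_inP/idP => [[y yx]|px]; first by rewrite (invariant_porbit inv yx).
by exists x; rewrite ?porbit_id.
Qed.

Variable rho : bool -> S.

Definition label_eval phi (T : {set {set darc D}}) : S := \prod_(C in T) rho (circle_color phi C).

Definition eval_at v phi (F : lres D -> S) : S :=
  \sum_(T : {set {set darc D}}) F (v, T) * label_eval phi T.

(** A merge acts by 1. A split of a circle evaluated at the root r acts by 2r - h, the difference of
    r and the other root. If the two new circles receive different roots, the colouring does not
    descend to [v] and the comultiplication evaluates to 0. *)
Definition edge_weight v c (phi : darc D -> bool) : S :=
  if invariant_under (perm_of v) phi then
    if cross_y c \in porbit (perm_of v) (cross_x c)
    then rho (phi (cross_x c)) - rho (~~ phi (cross_x c)) else 1
  else 0.

(** With these parameters the values of [rho] are the roots of Y^2 - hY - t. *)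
Local Notation h := (rho false + rho true).
Local Notation t := (- (rho false * rho true)).

Lemma frob_edge_eval (v : resolution D) c phi (T : {set {set darc D}}) :
  c \notin v -> invariant_under (perm_of (c |: v)) phi ->
  T \subset circles v ->
  \sum_(T' : {set {set darc D}}) frob_edge h t (circles v) (circles (c |: v)) T T' * label_eval phi T'
  = edge_weight v c phi * label_eval phi T.
Proof.
move=> cv inv TK; have := circle_perm_add Dplanar cv; rewrite /edge_weight.
set x := cross_x c; set y := cross_y c => pE.
have col w : circle_color phi (porbit (perm_of (c |: v)) w) = phi w := circle_color_porbit w inv.
have [yx|yx] := boolP (_ \in _).
  have t_xy : porbit (perm_of (c |: v)) x != porbit (perm_of (c |: v)) y.
    by rewrite eq_sym eq_porbit_mem pE porbit_tperm_split ?cross_neq.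
  apply: (frob_edge_split (C1 := porbit (perm_of (c |: v)) x) (C2 := porbit (perm_of (c |: v)) y)
    (C3 := porbit (perm_of v) x)) => //.
  - by rewrite !(circles_porbits Dplanar) pE porbits_split_old ?cross_neq.
  - by rewrite !(circles_porbits Dplanar) pE porbits_split_new ?cross_neq.
  - rewrite !col; case: ifP => [/invariant_porbit/(_ yx) -> | invF]; first by case: (phi x); ring.
    suff : phi x != phi y by do 2![case: (phi _)] => //= _; ring.
    by apply: contraFN invF => /eqP e; rewrite -(invariant_tperm _ e) -pE.
  rewrite !col; case: ifP => [invT|invF].
    by rewrite (invariant_porbit invT yx) circle_color_porbit //; case: (phi x); ring.
  rewrite mul0r; suff : phi x != phi y by do 2![case: (phi _)] => //= _; ring.
  by apply: contraFN invF => /eqP e; rewrite -(invariant_tperm _ e) -pE.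
have yx' : phi y = phi x by apply: (invariant_porbit inv); rewrite pE porbit_tperm_merge.
have inv' : invariant_under (perm_of v) phi by rewrite -(invariant_tperm _ (esym yx')) -pE.
rewrite inv' mul1r.
apply: (frob_edge_merge (C1 := porbit (perm_of v) x) (C2 := porbit (perm_of v) y)
    (C3 := porbit (perm_of (c |: v)) x)) => //.
- by rewrite eq_sym eq_porbit_mem.
- by rewrite !(circles_porbits Dplanar) pE porbits_merge_old.
- by rewrite !(circles_porbits Dplanar) pE porbits_merge_new.
- by rewrite col circle_color_porbit.
- by rewrite col circle_color_porbit // yx'.
by rewrite col; case: (phi x); ring.
Qed.

(* [F'] takes at each colouring the values of the cube differential of [F]. *)
Definition cube_related (F F' : lres D -> S) : Prop :=
  forall v phi, invariant_under (perm_of v) phi -> ~~ phi ord0 ->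
  eval_at v phi F' =
  \sum_(c in v) cube_sign (v :\ c) c * edge_weight (v :\ c) c phi * eval_at (v :\ c) phi F.

Definition circle_supported (F : lres D -> S) := forall s, F s != 0 -> s.2 \subset circles s.1.

Lemma frob_cube_related F : circle_supported F ->
  cube_related F (fun s' => \sum_s F s * frob_cube h t s s').
Proof.
move=> FK v' phi inv _; rewrite /eval_at.
transitivity (\sum_(s : lres D) \sum_(c | (c \notin s.1) && (v' == c |: s.1))
   cube_sign s.1 c * edge_weight s.1 c phi * (F s * label_eval phi s.2)).
  under eq_bigr => T' _ do rewrite big_distrl /=.
  rewrite exchange_big /=; apply: eq_bigr => s _.
  have [-> |Fs] := eqVneq (F s) 0.
    by rewrite !big1 // => [c _|T' _]; rewrite ?mul0r ?mulr0.
  under eq_bigr => T' _ do rewrite -mulrA /frob_cube big_distrl big_distrr /=.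
  rewrite exchange_big /=; apply: eq_bigr => c /andP[cs /eqP v'E].
  rewrite -mulrA (mulrCA _ (F s)) -frob_edge_eval ?FK // -?v'E //.
  by rewrite !big_distrr /=; apply: eq_bigr => T' _; ring.
rewrite (eq_bigr (fun s : lres D => (fun (v : resolution D) (T : {set {set darc D}}) =>
   \sum_(c | (c \notin v) && (v' == c |: v))
   cube_sign v c * edge_weight v c phi * (F (v, T) * label_eval phi T)) s.1 s.2)); last by case.
rewrite -(pair_bigA _ (fun (v : resolution D) (T : {set {set darc D}}) =>
   \sum_(c | (c \notin v) && (v' == c |: v))
   cube_sign v c * edge_weight v c phi * (F (v, T) * label_eval phi T))) /=.
under eq_bigr => v _ do rewrite exchange_big /=.
rewrite (exchange_big_dep (fun c => c \in v')) /= => [|v c _ /andP[_ /eqP ->]]; last by rewrite setU11.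
apply: eq_bigr => c cv'; rewrite (big_pred1 (v' :\ c)) => [|v].
  by rewrite big_distrr.
apply/andP/eqP => [[cv /eqP ->]|->]; first by rewrite setU1K.
by rewrite setD1K // !inE eqxx.
Qed.

(** Adding [c] to the resolution changes the sign at the later crossing [c'], while adding [c'] does
    not change the sign at [c]. *)
Lemma cube_sign_swap (v : resolution D) c c' : c \notin v -> c' \notin v -> (c < c')%N ->
  cube_sign v c * cube_sign (c |: v) c' = - (cube_sign v c' * cube_sign (c' |: v) c).
Proof.
move=> cv cv' cc'; rewrite /cube_sign.
have -> : [set j in c |: v | (j < c')%N] = c |: [set j in v | (j < c')%N].
  by apply/setP => j; rewrite !inE; case: eqP => // ->.
have -> : [set j in c' |: v | (j < c)%N] = [set j in v | (j < c)%N].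
  by apply/setP => j; rewrite !inE; case: eqP => // ->; rewrite ltnNge ltnW ?andbF.
by rewrite cardsU1 inE (negbTE cv) add1n exprS; ring.
Qed.

(** If both crossings lie on circles of the same colour, all splits have the same weight, and their
    number is fixed by the numbers of circles at the two ends of the square. If the colours differ,
    the crossings lie on different circles, so changing one does not affect whether the other
    splits. *)
Lemma edge_weight_swap (v : resolution D) c c' phi : c \notin v -> c' \notin v -> c != c' ->
  invariant_under (perm_of (c' |: (c |: v))) phi ->
  edge_weight v c phi * edge_weight (c |: v) c' phi
  = edge_weight v c' phi * edge_weight (c' |: v) c phi.
Proof.
move=> cv cv' cc' inv; rewrite /edge_weight.
have [inv0|] := boolP (invariant_under (perm_of v) phi); last by rewrite !mul0r.
have cv2 : c' \notin c |: v by rewrite !inE eq_sym negb_or cc'.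
have cv2' : c \notin c' |: v by rewrite !inE negb_or cc'.
have p1 := circle_perm_add Dplanar cv; have p1' := circle_perm_add Dplanar cv'.
have p2 := circle_perm_add Dplanar cv2; have p2' := circle_perm_add Dplanar cv2'.
have invE : invariant_under (perm_of (c |: v)) phi = invariant_under (perm_of (c' |: v)) phi.
  apply/idP/idP => i.
    by rewrite p1' invariant_tperm //; apply: (invariant_tperm_eq i); rewrite -p2.
  by rewrite p1 invariant_tperm //; apply: (invariant_tperm_eq i); rewrite -p2' setUCA.
rewrite invE; have [i'|] := boolP (invariant_under (perm_of (c' |: v)) phi); last by rewrite !mulr0.
have i := i'; rewrite -invE in i.
have xy : phi (cross_x c) = phi (cross_y c) by apply: (invariant_tperm_eq inv0); rewrite -p1.
have xy' : phi (cross_x c') = phi (cross_y c') by apply: (invariant_tperm_eq inv0); rewrite -p1'.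
have [xx|xx] := eqVneq (phi (cross_x c)) (phi (cross_x c')).
  have := porbits_mul_tperm (perm_of v) (cross_x c) (cross_y c).
  have := porbits_mul_tperm (perm_of v) (cross_x c') (cross_y c').
  have := porbits_mul_tperm (perm_of (c |: v)) (cross_x c') (cross_y c').
  have := porbits_mul_tperm (perm_of (c' |: v)) (cross_x c) (cross_y c).
  rewrite /= -p1 -p1' -p2 -p2' setUCA !cross_neq ![cross_x _ \in _]porbit_sym xx.
  by move=> e1 e2 e3 e4; apply: split_count e4 e2 e3 e1.
have out d d' : phi (cross_x d) = phi (cross_y d) -> phi (cross_x d) != phi (cross_x d') ->
    porbit (tperm (cross_x d) (cross_y d) * perm_of v)%g (cross_x d') = porbit (perm_of v) (cross_x d').
  move=> e ne; apply: porbit_tperm_out; apply: contra ne => /(invariant_porbit inv0).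
    by move=> ->.
  by rewrite e => ->.
by rewrite p1 p1' (out c c') // (out c' c) 1?eq_sym // mulrC.
Qed.

Lemma sum_antisym (P : pred 'I_n) (a : 'I_n -> 'I_n -> S) :
  (forall c c', P c -> P c' -> (c < c')%N -> a c c' = - a c' c) ->
  \sum_(c | P c) \sum_(c' | P c' && (c' != c)) a c c' = 0.
Proof.
move=> anti; rewrite pair_big_dep /=.
rewrite (bigID (fun p : 'I_n * 'I_n => (p.1 < p.2)%N)) /= addrC.
rewrite (reindex_inj (h := fun p : 'I_n * 'I_n => (p.2, p.1))) /=; last by case=> ? ? [? ?] [-> ->].
rewrite (eq_bigl (fun p : 'I_n * 'I_n => P p.1 && (P p.2 && (p.2 != p.1)) && (p.1 < p.2)%N)); last first.
  move=> [c c'] /=; rewrite -leqNgt andbCA eq_sym; case: (P c); case: (P c') => //=.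
  by rewrite leq_eqVlt -val_eqE eq_sym; case: (ltngtP c c').
rewrite -big_split big1 //= => -[c c'] /= /andP[/andP[Pc /andP[Pc' _]] cc'].
by rewrite (anti c c') // subrr.
Qed.

(** The double sum runs over ordered pairs of distinct crossings; exchanging them preserves the
    product of the weights and negates the product of the signs. *)
Lemma cube_square0 F F' F'' : cube_related F F' -> cube_related F' F'' ->
  forall v phi, invariant_under (perm_of v) phi -> ~~ phi ord0 -> eval_at v phi F'' = 0.
Proof.
move=> FF' FF'' v phi inv p0; rewrite FF'' //.
pose a c c' := cube_sign (v :\ c) c * edge_weight (v :\ c) c phi *
  (cube_sign (v :\ c :\ c') c' * edge_weight (v :\ c :\ c') c' phi * eval_at (v :\ c :\ c') phi F).
transitivity (\sum_(c in v) \sum_(c' | (c' \in v) && (c' != c)) a c c').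
  apply: eq_bigr => c cv; rewrite -big_distrr /=.
  (* The relation for [F'] is available only at colourings that descend to [v :\ c]; at the others
     the weight is 0. *)
  have [inv'|invF] := boolP (invariant_under (perm_of (v :\ c)) phi); last first.
    by rewrite /edge_weight (negbTE invF) mulr0 !mul0r.
  by rewrite FF' //; congr (_ * _); apply: eq_bigl => c'; rewrite !inE andbC.
apply: sum_antisym => c c' cv cv' cc'.
have cc : c != c' by rewrite -val_eqE neq_ltn cc'.
pose w := v :\ c :\ c'.
have wE : v :\ c' :\ c = w by apply/setP => j; rewrite !inE andbCA.
have w1 : v :\ c = c' |: w by rewrite setD1K // !inE eq_sym cc.
have w2 : v :\ c' = c |: w by rewrite -wE setD1K // !inE cc.
have cw : c \notin w by rewrite !inE eqxx andbF.
have cw' : c' \notin w by rewrite !inE eqxx.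
have vE : c |: (c' |: w) = v by rewrite -w1 setD1K.
have inv1 : invariant_under (perm_of (c |: (c' |: w))) phi by rewrite vE.
rewrite /a wE -/w w1 w2.
have e1 := cube_sign_swap cw cw' cc'.
have e2 := edge_weight_swap cw' cw _ inv1.
rewrite -[RHS]/(- (_ * _ * (_ * _ * eval_at w phi F))).
rewrite [LHS](_ : _ = (cube_sign w c' * cube_sign (c' |: w) c) *
  (edge_weight w c' phi * edge_weight (c' |: w) c phi) * eval_at w phi F); last by ring.
rewrite e2 1?eq_sym // -[cube_sign w c' * _]opprK -e1; ring.
Qed.

Hypothesis rho_reg : forall x, (rho true - rho false) * x = 0 -> x = 0.

Definition base_supported (F : lres D -> S) :=
  forall s, F s != 0 -> s.2 \subset circles s.1 :\ base_circle s.1.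

Lemma eval_at_inj F : base_supported F ->
  (forall v phi, invariant_under (perm_of v) phi -> ~~ phi ord0 -> eval_at v phi F = 0) ->
  forall s, F s = 0.
Proof.
move=> FK F0 [v T]; move: T; apply: (labels_eq0 rho_reg) => psi.
(* Any choice of roots for the circles gives a colouring of the arcs after setting the base circle
   to false; the labellings in the support do not contain that circle. *)
pose phi x := (porbit (perm_of v) x != base_circle v) && psi (porbit (perm_of v) x).
have inv : invariant_under (perm_of v) phi by apply/forallP => x; rewrite /phi porbit_perm1.
rewrite -[RHS](F0 v phi inv); last by rewrite /phi (base_circle_porbit Dplanar) eqxx.
apply: eq_bigr => T _; have [->|/FK TK] := eqVneq (F (v, T)) 0; first by rewrite !mul0r.
congr (_ * _); apply: eq_bigr => C CT; congr (rho _).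
have := subsetP TK _ CT; rewrite !inE /= (circles_porbits Dplanar) => /andP[Cb /imsetP[x _ CE]].
by rewrite CE circle_color_porbit // /phi -CE Cb.
Qed.
End Cube.

(** * The ring A *)

Definition GA : Auniv := 2 * XA - hA.

(* The values at the two roots of Y^2 - hY - t over A, resp. those of Z^2 + GZ, where Z = Y - X. *)
Definition root_Y (b : bool) : Auniv := if b then hA - XA else XA.
Definition root_Z (b : bool) : Auniv := if b then - GA else 0.

Lemma root_Y_sum : root_Y false + root_Y true = hA.
Proof. by rewrite /root_Y addrC subrK. Qed.

Lemma root_Y_prod : - (root_Y false * root_Y true) = tA.
Proof. by rewrite /root_Y mulrBr opprB -expr2 XA_sqr [XA * _]mulrC addrC addKr. Qed.

Lemma root_Z_sum : root_Z false + root_Z true = - GA.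
Proof. by rewrite add0r. Qed.

Lemma root_Z_prod : - (root_Z false * root_Z true) = 0.
Proof. by rewrite mul0r oppr0. Qed.

Lemma root_YZ b : root_Y b = XA + root_Z b.
Proof.
case: b; rewrite /= ?addr0 // /GA mulr_natl mulr2n opprB addrCA; congr (_ + _).
by rewrite opprD addrA subrr add0r.
Qed.

Lemma root_sub b : root_Y b - root_Y (~~ b) = root_Z b - root_Z (~~ b).
Proof. by rewrite !root_YZ opprD addrACA subrr add0r. Qed.

Lemma acoef_eq0 (a : Auniv) : acoef 0 a = 0 -> acoef 1 a = 0 -> a = 0.
Proof. by move=> a0 a1; rewrite [a]AunivE a0 a1 !scale0r mul0r addr0. Qed.

Lemma GA_sqr : GA ^+ 2 = (hR ^+ 2 + 4 * tR)%:A.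
Proof.
have sq (S : comNzRingType) (x h t : S) : x ^+ 2 = h * x + t -> (2 * x - h) ^+ 2 = h ^+ 2 + 4 * t.
  move=> e; have -> : (2 * x - h) ^+ 2 = 4 * x ^+ 2 - 4 * h * x + h ^+ 2 by ring.
  by rewrite e; ring.
by rewrite /GA (sq _ _ _ _ XA_sqr) -[RHS]in_algE rmorphD rmorphXn rmorphM rmorph_nat.
Qed.

(** The square of G is the discriminant h^2 + 4t, a nonzero element of the domain Z[h,t], over which
    A is free. *)
Lemma GA_reg (a : Auniv) : GA * a = 0 -> a = 0.
Proof.
move=> Ga; have d0 : hR ^+ 2 + 4 * tR != 0.
  (* Setting t = 0 leaves h^2. *)
  apply/eqP => /(congr1 (fun p => p.[0])); rewrite /hR /tR -rmorphXn /=.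
  rewrite hornerD hornerC hornerM hornerX mulr0 addr0 horner0 => /eqP.
  by rewrite expf_eq0 /= polyX_eq0.
have : GA ^+ 2 * a = 0 by rewrite expr2 -mulrA Ga mulr0.
rewrite GA_sqr mulr_algl => e.
by apply: acoef_eq0; apply: (mulfI d0); rewrite mulr0 -acoefZ e /acoef linear0 coef0.
Qed.

Lemma root_Y_reg a : (root_Y true - root_Y false) * a = 0 -> a = 0.
Proof.
rewrite (root_sub true) /= subr0 mulNr => /eqP; rewrite oppr_eq0 => /eqP; exact: GA_reg.
Qed.

Lemma root_Z_reg a : (root_Z true - root_Z false) * a = 0 -> a = 0.
Proof. by rewrite -(root_sub true); apply: root_Y_reg. Qed.

Lemma frob_mul_acoef (k k' : nat) : (k <= 2)%N -> (k' <= 1)%N ->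
  frob_mul hA tA k k' = (mul_coef k k')%:A.
Proof.
case: k => [|[|[|//]]] _; case: k' => [|[|//]] _; rewrite /mul_coef.
- by rewrite expr0 (acoef_XA false false) scale1r.
- by rewrite expr0 (acoef_XA true false) scale0r.
- by rewrite (acoef_XA false true) scale0r.
- by rewrite (acoef_XA true true) scale1r.
- rewrite XA_sqr /hA /tA mulr_algl acoefD !acoefZ (acoef_XA false true) (acoef_XA false false).
  by rewrite mulr0 mulr1 add0r.
rewrite XA_sqr /hA /tA mulr_algl acoefD !acoefZ (acoef_XA true true) (acoef_XA true false).
by rewrite mulr0 mulr1 addr0.
Qed.

Lemma frob_comul_coef k k' : frob_comul hA tA k k' = (comul_coef k k')%:A.
Proof.
by case: k => [|[|k]]; case: k' => [|[|[|k']]]; rewrite /= ?scale0r ?scale1r ?scaleNr.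
Qed.

Lemma frob_match_coef o l k k' : (o = 2%N -> (k <= 2)%N) -> (l = 1%N -> (k' <= 1)%N) ->
  match o, l with 2, 1 => frob_mul hA tA k k' | 1, 2 => frob_comul hA tA k k' | _, _ => 0 end =
  (match o, l with 2, 1 => mul_coef k k' | 1, 2 => comul_coef k k' | _, _ => 0 end)%:A.
Proof.
case: o => [|[|[|o]]] ok; [by rewrite scale0r| | |by rewrite scale0r].
  by case: l => [|[|[|l]]] lk; rewrite ?frob_comul_coef ?scale0r.
by case: l => [|[|l]] lk; rewrite ?scale0r // frob_mul_acoef ?ok ?lk.
Qed.

Lemma frob_cube_coef (D : gauss_code) (s s' : lres D) :
  frob_cube hA tA s s' = (cube_coef s s')%:A.
Proof.
rewrite /cube_coef scaler_suml; apply: eq_bigr => c _; rewrite -[RHS]in_algE rmorphM rmorphXn rmorphN1.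
congr (_ * _); rewrite /= /edge_coef /frob_edge; case: s => v T; case: s' => v' T' /=.
case: ifP => _; last by rewrite scale0r.
by apply: frob_match_coef => <-; apply/subset_leq_card/subsetIr.
Qed.

(** * Homogeneous elements *)

Section Grading.

Lemma Rhomog0 q : Rhomog q 0.
Proof. by move=> i j; rewrite !coef0 eqxx. Qed.

Lemma RhomogD q p p' : Rhomog q p -> Rhomog q p' -> Rhomog q (p + p').
Proof.
move=> hp hp' i j; rewrite !coefD => n0; have [p0|/hp //] := eqVneq (p`_j`_i) 0.
by apply: hp'; move: n0; rewrite p0 add0r.
Qed.

Lemma RhomogN q p : Rhomog q p -> Rhomog q (- p).
Proof. by move=> hp i j; rewrite !coefN oppr_eq0; apply: hp. Qed.

Lemma Rhomog_hR q p : Rhomog q p -> Rhomog (q - 2) (hR * p).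
Proof.
move=> hp i j; rewrite coefCM coefXM; case: i => [|i]; rewrite ?eqxx //= => /hp ->; lia.
Qed.

Lemma Rhomog_tR q p : Rhomog q p -> Rhomog (q - 4) (tR * p).
Proof.
move=> hp i j; rewrite coefXM; case: j => [|j]; rewrite ?coef0 ?eqxx //= => /hp ->; lia.
Qed.

Lemma Ahomog0 q : Ahomog q 0.
Proof. by rewrite /Ahomog /acoef linear0 !coef0; split; apply: Rhomog0. Qed.

Lemma AhomogD q a b : Ahomog q a -> Ahomog q b -> Ahomog q (a + b).
Proof. by move=> [a0 a1] [b0 b1]; rewrite /Ahomog !acoefD; split; apply: RhomogD. Qed.

Lemma acoefN k a : acoef k (- a) = - acoef k a.
Proof. by rewrite /acoef linearN coefN. Qed.

Lemma AhomogN q a : Ahomog q a -> Ahomog q (- a).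
Proof. by move=> [a0 a1]; rewrite /Ahomog !acoefN; split; apply: RhomogN. Qed.

Lemma Ahomog_alg q r : Rhomog q r -> Ahomog q r%:A.
Proof.
move=> hr; rewrite /Ahomog !acoefZ (acoef_XA false false) (acoef_XA true false) mulr1 mulr0.
by split=> //; apply: Rhomog0.
Qed.

Lemma Ahomog_hA q a : Ahomog q a -> Ahomog (q - 2) (hA * a).
Proof.
case=> a0 a1; rewrite /hA mulr_algl /Ahomog !acoefZ; split; first exact: Rhomog_hR.
by rewrite addrAC; apply: Rhomog_hR.
Qed.

Lemma Ahomog_XA q a : Ahomog q a -> Ahomog (q - 2) (XA * a).
Proof.
case=> a0 a1; have aE : XA * a = (tR * acoef 1 a)%:A + (acoef 0 a + hR * acoef 1 a)%:A * XA.
  have gen (S : comNzRingType) (x h t u w : S) : x ^+ 2 = h * x + t ->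
      x * (u + w * x) = t * w + (u + h * w) * x.
    by move=> e; rewrite (_ : x * _ = x * u + w * x ^+ 2); [rewrite e; ring|ring].
  rewrite {1}[a]AunivE (gen _ _ _ _ _ _ XA_sqr) /hA /tA.
  by rewrite !mulrDl !mulr_algl !scalerDl !scalerA !mulr_algl.
have c0 (r r' : Runiv) : acoef 0 (r%:A + r'%:A * XA) = r.
  by rewrite mulr_algl acoefD !acoefZ (acoef_XA false false) (acoef_XA false true) mulr1 mulr0 addr0.
have c1 (r r' : Runiv) : acoef 1 (r%:A + r'%:A * XA) = r'.
  by rewrite mulr_algl acoefD !acoefZ (acoef_XA true false) (acoef_XA true true) mulr1 mulr0 add0r.
rewrite /Ahomog aE c0 c1; split; first by have := Rhomog_tR a1; rewrite (_ : q + 2 - 4 = q - 2) //; lia.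
by rewrite subrK; apply: RhomogD => //; have := Rhomog_hR a1; rewrite addrK.
Qed.

Lemma Ahomog_GA q a : Ahomog q a -> Ahomog (q - 2) (GA * a).
Proof.
move=> ha; rewrite /GA mulrBl mulr_natl mulr2n mulrDl.
by apply: AhomogD; [apply: AhomogD; apply: Ahomog_XA|apply/AhomogN/Ahomog_hA].
Qed.

Lemma Ahomog_exp (g : Auniv) : (forall q a, Ahomog q a -> Ahomog (q - 2) (g * a)) ->
  forall k q a, Ahomog q a -> Ahomog (q - (2 * k)%N%:Z) (g ^+ k * a).
Proof.
move=> hg; elim=> [|k IH] q a ha; first by rewrite muln0 subr0 mul1r.
rewrite exprS -mulrA (_ : _ - _ = q - (2 * k)%N%:Z - 2); last by lia.
exact/hg/IH.
Qed.

Lemma Ahomog_mulz q a m : Ahomog q a -> Ahomog q (a *~ m).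
Proof.
move=> ha; have nat_ k : Ahomog q (a *+ k).
  by elim: k => [|k IH]; rewrite ?mulr0n ?mulrS; [apply: Ahomog0|apply: AhomogD].
by case: m => k; rewrite ?NegzE ?mulrNz -pmulrn //; apply: AhomogN.
Qed.

Lemma Ahomog_sum (I : Type) (r : seq I) (P : pred I) (F : I -> Auniv) q :
  (forall i, P i -> Ahomog q (F i)) -> Ahomog q (\sum_(i <- r | P i) F i).
Proof. by move=> hF; apply: big_ind => //; [apply: Ahomog0|move=> a b; apply: AhomogD]. Qed.
End Grading.

(** * The change of basis *)

Section ChangeOfLabels.
Variables (D : gauss_code) (S : comNzRingType).
Local Notation labels := {set {set darc D}}.

Lemma eval_at_linear (rho : bool -> S) v phi a (F F' : lres D -> S) :
  eval_at rho v phi (fun s => a * F s + F' s) = a * eval_at rho v phi F + eval_at rho v phi F'.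
Proof.
rewrite /eval_at big_distrr -big_split /=; apply: eq_bigr => T _.
by rewrite mulrDl mulrA.
Qed.

Lemma eq_eval_at (rho : bool -> S) v phi (F F' : lres D -> S) :
  F =1 F' -> eval_at rho v phi F = eval_at rho v phi F'.
Proof. by move=> FF; apply: eq_bigr => T _; rewrite FF. Qed.

(** The coefficients after the substitution Y = d + Z at every circle: the monomial of [U] expands
    into the monomials of its subsets. *)
Definition shift_labels (d : S) (F : lres D -> S) (s : lres D) : S :=
  \sum_(U : labels | s.2 \subset U) d ^+ #|U :\: s.2| * F (s.1, U).

Lemma eval_shift (rho rho' : bool -> S) d v phi F : (forall b, rho b = d + rho' b) ->
  eval_at rho' v phi (shift_labels d F) = eval_at rho v phi F.
Proof.
move=> rhoE; rewrite /eval_at /shift_labels /=.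
under eq_bigr => T _ do rewrite big_distrl /=.
rewrite (exchange_big_dep predT) //=; apply: eq_bigr => U _.
under eq_bigr => T _ do rewrite (mulrC (d ^+ _)) -mulrA.
rewrite -big_distrr /=; congr (_ * _).
have -> : label_eval rho phi U = \prod_(C : {set darc D})
  ((if C \in U then rho' (circle_color phi C) else 0)
   + (if C \in U then d else 1)).
  rewrite /label_eval big_mkcond; apply: eq_bigr => C _.
  by case: ifP; rewrite ?add0r // rhoE addrC.
rewrite bigA_distr [RHS](bigID (fun T : labels => T \subset U)) /=.
rewrite [X in _ = _ + X]big1 ?addr0 => [|T /subsetPn[C CT CU]]; last first.
  by rewrite (bigD1 C) //= CT (negbTE CU) mul0r.
apply: eq_bigr => T TU; rewrite (bigID (mem T)) /= mulrC; congr (_ * _).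
  by apply: eq_bigr => C CT; rewrite CT (subsetP TU).
rewrite -prodr_const big_mkcond [RHS]big_mkcond; apply: eq_bigr => C _.
by rewrite inE; case: (C \in T); case: (C \in U).
Qed.

End ChangeOfLabels.

Lemma relabel_subset (I : finType) (K K' T T' : {set I}) :
  T \subset K -> T :\: (K :\: K') = T' :\: (K' :\: K) -> T' \subset K'.
Proof.
move=> TK TT'; apply/subsetP => C CT'; apply/negPn/negP => CK'.
have : C \in T' :\: (K' :\: K) by rewrite !inE (negbTE CK') andbF.
by rewrite -TT' !inE (negbTE CK') /= => /andP[/negP + CT]; apply; apply: (subsetP TK).
Qed.

Lemma frob_edge_subset (I : finType) (S : comNzRingType) (h t : S) (K K' T T' : {set I}) :
  T \subset K -> frob_edge h t K K' T T' != 0 -> T' \subset K'.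
Proof.
by move=> TK; rewrite /frob_edge; case: ifP => [/eqP /(relabel_subset TK) //|]; rewrite eqxx.
Qed.

Section Extension.
Variables (I : finType) (L : eqType) (S : nzRingType) (lab : I -> L).
Hypothesis lab_inj : injective lab.

Definition extend_by0 (x : I -> S) (s : L) : S := \sum_(k | lab k == s) x k.

Lemma extend_by0E x k : extend_by0 x (lab k) = x k.
Proof. by rewrite /extend_by0 (big_pred1 k) // => j; rewrite (inj_eq lab_inj). Qed.

Lemma extend_by0_out x s : (forall k, lab k != s) -> extend_by0 x s = 0.
Proof. by move=> ks; rewrite /extend_by0 big_pred0 // => k; rewrite (negbTE (ks k)). Qed.
End Extension.

Lemma sum_extend_by0 (I L : finType) (S : nzRingType) (lab : I -> L) (x : I -> S) (F : L -> S) :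
  \sum_s extend_by0 lab x s * F s = \sum_k x k * F (lab k).
Proof.
under eq_bigr => s _ do rewrite big_distrl /=.
rewrite (exchange_big_dep predT) //=; apply: eq_bigr => k _.
by rewrite (big_pred1 (lab k)) // => s; rewrite eq_sym.
Qed.

(** Multiplication by [a] in coordinates over 1 and X; the [b]'s are the coordinates of a X. *)
Lemma act_coords (S : comNzRingType) (a X a0 a1 b0 b1 u w : S) :
  a0 + a1 * X = a -> b0 + b1 * X = a * X ->
  (b0 * w + a0 * u) + (b1 * w + a1 * u) * X = a * (u + w * X).
Proof.
move=> ea eb; transitivity ((b0 + b1 * X) * w + (a0 + a1 * X) * u); first by ring.
by rewrite ea eb; ring.
Qed.

(** * The reduced complex over A *)

Section Reduction.
Variables (D : gauss_code) (Dplanar : planar D).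
Local Notation labels := {set {set darc D}}.
Local Notation perm_of v := (circle_perm Dplanar v).

(** The factor of the base circle supplies the scalars in A, so the labellings of the remaining
    circles form an A-basis. *)
Definition reduced_at i (s : lres D) : bool := lres_at i s && ~~ base_label s.
Definition reduced_gen i := {s : lres D | reduced_at i s}.
Definition red_rk (i : int) : nat := #|{: reduced_gen i}|.
Definition red_lab i (k : 'I_(red_rk i)) : lres D := val (enum_val k : reduced_gen i).
Definition red_sh i (k : 'I_(red_rk i)) : int := qdeg (red_lab k).
Definition red_mx i : 'M[Auniv]_(red_rk (i + 1), red_rk i) :=
  \matrix_(a, b) frob_cube (- GA) 0 (red_lab b) (red_lab a).

Lemma red_labP i (k : 'I_(red_rk i)) : reduced_at i (red_lab k).
Proof. exact: valP. Qed.

Lemma red_lab_inj i : injective (@red_lab i).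
Proof. by move=> k k' /val_inj/enum_val_inj. Qed.

Lemma red_lab_onto i s : reduced_at i s -> exists k : 'I_(red_rk i), red_lab k = s.
Proof. by move=> si; exists (enum_rank (Sub s si : reduced_gen i)); rewrite /red_lab enum_rankK. Qed.

Definition ext_red i (z : 'cV[Auniv]_(red_rk i)) : lres D -> Auniv :=
  extend_by0 (@red_lab i) (fun k => z k 0).

Definition ext_full i (x : Cmod D i) : lres D -> Auniv :=
  extend_by0 (fun g : gen D i => val g) (fun g => (x g)%:A).

Lemma ext_redE i (z : 'cV[Auniv]_(red_rk i)) k : ext_red z (red_lab k) = z k 0.
Proof. exact: (extend_by0E (@red_lab_inj i)). Qed.

Lemma ext_red_out i (z : 'cV[Auniv]_(red_rk i)) s : ~~ reduced_at i s -> ext_red z s = 0.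
Proof. by move=> si; apply: extend_by0_out => k; apply: contraNneq si => <-; apply: red_labP. Qed.

Lemma ext_red_neq0 i (z : 'cV[Auniv]_(red_rk i)) s : ext_red z s != 0 -> reduced_at i s.
Proof. by apply: contraNT => /(ext_red_out z) ->. Qed.

Lemma ext_fullE i (x : Cmod D i) g : ext_full x (val g) = (x g)%:A.
Proof. exact: (extend_by0E val_inj). Qed.

Lemma ext_full_out i (x : Cmod D i) s : ~~ lres_at i s -> ext_full x s = 0.
Proof. by move=> si; apply: extend_by0_out => k; apply: contraNneq si => <-; apply: valP. Qed.

Lemma ext_full_neq0 i (x : Cmod D i) s : ext_full x s != 0 -> lres_at i s.
Proof. by apply: contraNT => /(ext_full_out x) ->. Qed.

Lemma ext_red_linear i a (z z' : 'cV[Auniv]_(red_rk i)) s :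
  ext_red (a *: z + z') s = a * ext_red z s + ext_red z' s.
Proof.
have [/red_lab_onto[k <-]|si] := boolP (reduced_at i s); first by rewrite !ext_redE !mxE.
by rewrite !ext_red_out // mulr0 addr0.
Qed.

Lemma ext_full_add i (x y : Cmod D i) s : ext_full (x + y) s = ext_full x s + ext_full y s.
Proof.
have [si|si] := boolP (lres_at i s); last by rewrite !ext_full_out // addr0.
by rewrite -[s](SubK (gen D i) si) !ext_fullE ffunE scalerDl.
Qed.

Lemma frob_cube_at (S : comNzRingType) (h t : S) i (s s' : lres D) :
  lres_at i s -> frob_cube h t s s' != 0 -> lres_at (i + 1) s'.
Proof.
case: s s' => v T [v' T'] /andP[/= TK vi] ne0; rewrite /lres_at /=.
have [c /andP[cv /eqP v'E]|none] := pickP (fun c => (c \notin v) && (v' == c |: v)); last first.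
  by rewrite /frob_cube big_pred0 ?eqxx in ne0.
apply/andP; split; last by rewrite v'E cardsU1 cv -(eqP vi) add1n -addn1 PoszD addrAC.
apply: (frob_edge_subset (h := h) (t := t) TK); apply: contraNneq ne0 => e0.
by rewrite /frob_cube big1 //= => d _; rewrite e0 mulr0.
Qed.

Lemma ext_full_Cdiff i (x : Cmod D i) s' :
  ext_full (Cdiff x) s' = \sum_s ext_full x s * frob_cube hA tA s s'.
Proof.
have [si|si] := boolP (lres_at (i + 1) s').
  rewrite -[s'](SubK (gen D (i + 1)) si) ext_fullE ffunE sum_extend_by0 scaler_suml.
  apply: eq_bigr => g _; rewrite frob_cube_coef -[LHS]in_algE rmorphM //.
rewrite ext_full_out // big1 // => s _; have [->|/ext_full_neq0 sx] := eqVneq (ext_full x s) 0.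
  by rewrite mul0r.
have [->|/(frob_cube_at sx)] := eqVneq (frob_cube hA tA s s') 0; first by rewrite mulr0.
by rewrite (negbTE si).
Qed.

Lemma base_color v phi : invariant_under (perm_of v) phi ->
  circle_color phi (base_circle v) = phi ord0.
Proof. by move=> inv; rewrite (base_circle_porbit Dplanar) circle_color_porbit. Qed.

Lemma label_eval_base0 v phi (T : labels) : invariant_under (perm_of v) phi -> ~~ phi ord0 ->
  base_circle v \in T -> label_eval root_Z phi T = 0.
Proof.
by move=> inv p0 bT; rewrite /label_eval (bigD1 (base_circle v)) //= base_color // (negbTE p0) mul0r.
Qed.

(** The base circle is evaluated at the root Y = X, that is at Z = 0, so labellings containing it
    contribute nothing. This is why [red_mx] may omit them. *)
Lemma eq_eval_base v phi F F' : invariant_under (perm_of v) phi -> ~~ phi ord0 ->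
  (forall s, ~~ base_label s -> F s = F' s) ->
  eval_at root_Z v phi F = eval_at root_Z v phi F'.
Proof.
move=> inv p0 FF'; apply: eq_bigr => T _; have [bT|bT] := boolP (base_circle v \in T).
  by rewrite (label_eval_base0 inv p0 bT) !mulr0.
by rewrite FF'.
Qed.

Lemma red_mx_related i (z : 'cV[Auniv]_(red_rk i)) :
  cube_related Dplanar root_Z (ext_red z) (ext_red (red_mx i *m z)).
Proof.
move=> v phi inv p0.
have zK : circle_supported (ext_red z) by move=> s /ext_red_neq0 /andP[/andP[]].
have := frob_cube_related root_Z zK inv p0.
rewrite root_Z_sum root_Z_prod => <-; apply: eq_eval_base => // s' bs'.
have [/red_lab_onto[k <-]|si] := boolP (reduced_at (i + 1) s').
  by rewrite ext_redE mxE sum_extend_by0; apply: eq_bigr => j _; rewrite mxE mulrC.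
rewrite ext_red_out // big1 // => s _; have [->|/ext_red_neq0/andP[sx _]] := eqVneq (ext_red z s) 0.
  by rewrite mul0r.
have [->|/(frob_cube_at sx)] := eqVneq (frob_cube (- GA) 0 s s') 0; first by rewrite mulr0.
by move=> sx'; rewrite /reduced_at sx' bs' in si.
Qed.

Lemma Cdiff_related i (x : Cmod D i) :
  cube_related Dplanar root_Y (ext_full x) (ext_full (Cdiff x)).
Proof.
move=> v phi inv p0.
have xK : circle_supported (ext_full x) by move=> s /ext_full_neq0 /andP[].
have := frob_cube_related root_Y xK inv p0.
rewrite root_Y_sum root_Y_prod => <-; apply: eq_eval_at => s'.
exact: ext_full_Cdiff.
Qed.

(** The roots for Y and Z differ by the translation by X, and a weight depends only on their
    difference; hence both differentials act alike on evaluations. *)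
Lemma edge_weight_YZ v c phi :
  edge_weight Dplanar root_Y v c phi = edge_weight Dplanar root_Z v c phi.
Proof. by rewrite /edge_weight root_sub. Qed.

Lemma eval_red_inj i (z z' : 'cV[Auniv]_(red_rk i)) :
  (forall v phi, invariant_under (perm_of v) phi -> ~~ phi ord0 ->
     eval_at root_Z v phi (ext_red z) = eval_at root_Z v phi (ext_red z')) -> z = z'.
Proof.
move=> zz'; have E s : ext_red (-1 *: z + z') s = 0.
  move: s; apply: (eval_at_inj (Dplanar := Dplanar) root_Z_reg).
    move=> s /ext_red_neq0 /andP[/andP[sK _] bs]; rewrite subsetD1 sK.
    exact: bs.
  move=> v phi inv p0; rewrite (eq_eval_at _ _ _ (ext_red_linear _ _ _)) eval_at_linear zz' //.
  by rewrite mulN1r addNr.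
apply/colP => k; have := E (red_lab k); rewrite ext_redE !mxE mulN1r => /eqP.
by rewrite addrC subr_eq0 => /eqP.
Qed.

(* The A-valued coordinates with respect to the labellings leaving the base circle unlabelled. *)
Definition merge_base (F : lres D -> Auniv) (s : lres D) : Auniv :=
  if base_label s then 0 else F s + F (set_base s true) * XA.

Lemma eval_merge_base v phi F : invariant_under (perm_of v) phi -> ~~ phi ord0 ->
  eval_at root_Y v phi (merge_base F) = eval_at root_Y v phi F.
Proof.
move=> inv p0; rewrite /eval_at [RHS](big_setU1_split (base_circle v)) -big_split /=.
rewrite [LHS](bigID (fun T : labels => base_circle v \notin T)) /=.
rewrite [X in _ + X]big1 ?addr0 => [|T]; last first.
  by rewrite negbK /merge_base /base_label /= => ->; rewrite mul0r.
apply: eq_big => [T|T bT]; first by rewrite andbT.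
rewrite /merge_base /base_label /= (negbTE bT) mulrDl -mulrA; congr (_ + _ * _).
by rewrite /label_eval big_setU1 //= base_color // (negbTE p0).
Qed.

Lemma merge_base_full_inj i (x : Cmod D i) : (forall s, merge_base (ext_full x) s = 0) -> x = 0.
Proof.
have alg0 (r r' : Runiv) : r%:A + r'%:A * XA = 0 -> r = 0 /\ r' = 0.
  move=> e; split.
    have := congr1 (acoef 0) e; rewrite mulr_algl acoefD !acoefZ.
    by rewrite (acoef_XA false false) (acoef_XA false true) mulr1 mulr0 addr0 /acoef linear0 coef0.
  have := congr1 (acoef 1) e; rewrite mulr_algl acoefD !acoefZ.
  by rewrite (acoef_XA true false) (acoef_XA true true) mulr1 mulr0 add0r /acoef linear0 coef0.
move=> x0; apply/ffunP => g; rewrite [RHS]ffunE.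
have := x0 (set_base (val g) false); rewrite /merge_base base_label_set set_base_set.
rewrite -[set_base _ false]/(val (gen_base g false)).
rewrite -[set_base _ true]/(val (gen_base g true)) !ext_fullE.
case/alg0 => f0 t0; have -> : g = gen_base g (base_label (val g)).
  by apply: val_inj; rewrite /= set_base_id.
by case: base_label.
Qed.

(** [eval_at_inj] requires supports avoiding the base circle; [merge_base] achieves this without
    changing the evaluations. *)
Lemma eval_full_inj i (x x' : Cmod D i) :
  (forall v phi, invariant_under (perm_of v) phi -> ~~ phi ord0 ->
     eval_at root_Y v phi (ext_full x) = eval_at root_Y v phi (ext_full x')) -> x = x'.
Proof.
move=> xx'; apply/eqP; rewrite -subr_eq0; apply/eqP/merge_base_full_inj.
have xK s : ext_full (x - x') s = -1 * ext_full x' s + ext_full x s.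
  by rewrite -[in RHS](subrK x' x) [in RHS]ext_full_add mulN1r addrCA addNr addr0.
apply: (eval_at_inj (Dplanar := Dplanar) root_Y_reg).
  move=> s; rewrite /merge_base; case: ifP => [|/negbT bs]; first by rewrite eqxx.
  move=> ne0; rewrite subsetD1 bs andbT.
  have [/ext_full_neq0/andP[]//|] := boolP (ext_full (x - x') s != 0).
  rewrite negbK => /eqP e; move: ne0; rewrite e add0r.
  have [->|/ext_full_neq0/andP[/= sK _] _] := eqVneq (ext_full (x - x') (set_base s true)) 0.
    by rewrite mul0r eqxx.
  by apply: subset_trans sK; apply: subsetUr.
move=> v phi inv p0; rewrite eval_merge_base // (eq_eval_at _ _ _ xK) eval_at_linear xx' //.
by rewrite mulN1r addNr.
Qed.

(** The base circle is evaluated at X, so the action of A on its factor becomes multiplication in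
    A. *)
Lemma eval_full_act i a (x : Cmod D i) v phi : invariant_under (perm_of v) phi -> ~~ phi ord0 ->
  eval_at root_Y v phi (ext_full (a *: x)) = a * eval_at root_Y v phi (ext_full x).
Proof.
move=> inv p0; rewrite -eval_merge_base // -[in RHS]eval_merge_base //.
rewrite /eval_at big_distrr /=; apply: eq_bigr => T _; rewrite mulrA; congr (_ * _).
rewrite /merge_base; case: ifP => [_|bs]; first by rewrite mulr0.
set s := (v, T); have s0 : set_base s false = s by rewrite -[RHS]set_base_id bs.
have [si|si] := boolP (lres_at i s); last first.
  have si' : ~~ lres_at i (set_base s true).
    by apply: contra si => /(set_base_at false); rewrite set_base_set s0.
  by rewrite !ext_full_out // mul0r addr0 mulr0.
pose g : gen D i := Sub s si.
have g0 : gen_base g false = g by apply: val_inj; rewrite /= s0.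
rewrite -[s]/(val g) -[set_base _ true]/(val (gen_base g true)) !ext_fullE.
rewrite -[a *: x]/(act_fun a x) /act_fun !ffunE !big_bool /=.
have -> : gen_base (gen_base g true) true = gen_base g true by apply: val_inj; rewrite /= set_base_set.
have -> : gen_base (gen_base g true) false = g.
  by apply: val_inj; rewrite /= set_base_set s0.
rewrite g0 base_label_set bs expr0 expr1 mulr1.
have split_ k : ((acoef 0 k)%:A + (acoef 1 k)%:A * XA = k :> Auniv) by rewrite -AunivE.
have mA (r r' : Runiv) : (r * r')%:A = r%:A * r'%:A :> Auniv by rewrite -[LHS]in_algE rmorphM.
rewrite !scalerDl !mA.
exact: act_coords (split_ a) (split_ (a * XA)).
Qed.
End Reduction.

(** The numerical equation is homogeneity: along the edge the quantum degree rises by 2k, matching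
    the degree -2k of G^k. *)
Lemma frob_edge_power (I : finType) (S : comNzRingType) (g : S) (K K' T T' : {set I}) :
  T \subset K -> exists (k : nat) (m : int),
    frob_edge (- g) 0 K K' T T' = g ^+ k *~ m /\
    (m != 0 -> T' \subset K' /\ (#|K'| + 2 * #|T| + 1 = #|K| + 2 * #|T'| + 2 * k)%N).
Proof.
move=> TK.
have zero : exists (k : nat) (m : int), 0 = g ^+ k *~ m /\
    (m != 0 -> T' \subset K' /\ (#|K'| + 2 * #|T| + 1 = #|K| + 2 * #|T'| + 2 * k)%N).
  by exists 0%N, 0; rewrite mulr0z eqxx.
rewrite /frob_edge; case: ifP => // /eqP TT'; have T'K' := relabel_subset TK TT'.
have := cardsID (K :\: K') T; have := cardsID (K' :\: K) T'; rewrite TT'.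
have := cardsID K' K; have := cardsID K K'; rewrite (setIC K').
have : (#|T :&: (K :\: K')| <= #|K :\: K'|)%N by rewrite subset_leq_card // subsetIr.
have : (#|T' :&: (K' :\: K)| <= #|K' :\: K|)%N by rewrite subset_leq_card // subsetIr.
move: (#|T :&: (K :\: K')|) (#|T' :&: (K' :\: K)|) (#|T' :\: (K' :\: K)|) (#|K :&: K'|) => a b c d.
move: #|K :\: K'| #|K' :\: K| zero => o l zero bl ao e1 e2 e3 e4.
have one k : (#|K'| + 2 * #|T| + 1 = #|K| + 2 * #|T'| + 2 * k)%N -> exists (k' : nat) (m : int),
    g ^+ k = g ^+ k' *~ m /\
    (m != 0 -> T' \subset K' /\ (#|K'| + 2 * #|T| + 1 = #|K| + 2 * #|T'| + 2 * k')%N).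
  by move=> e; exists k, 1; rewrite mulr1z.
(* First a split, with nonzero entries [g] and 1, then a merge, with nonzero entries 1 and [- g];
   everything else is zero. *)
case: o ao e1 e2 => [|[|[|o]]] ao e1 e2; case: l bl e1 e2 => [|[|[|l]]] bl e1 e2 //.
  case: a ao e4 => [|[|a]] ao e4; case: b bl e3 => [|[|[|b]]] bl e3 //=.
  - by rewrite opprK -[g]expr1; apply: one; lia.
  - by rewrite -(expr0 g); apply: one; lia.
  - by rewrite -(expr0 g); apply: one; lia.
case: a ao e4 => [|[|[|a]]] ao e4; case: b bl e3 => [|[|b]] bl e3 //=.
- by rewrite -(expr0 g); apply: one; lia.
- by rewrite -(expr0 g); apply: one; lia.
- by exists 1%N, (-1); rewrite mulrN1z; split=> // _; split=> //; lia.
Qed.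

(** * Quantum degrees and the maps between the two complexes *)

Section Degrees.
Variable D : gauss_code.
Local Notation labels := {set {set darc D}}.

Lemma qdegE (s : lres D) : s.2 \subset circles s.1 ->
  qdeg s = #|circles s.1|%:Z - (2 * #|s.2|)%N%:Z + (#|s.1|%:Z + (npos D)%:Z - 2 * (nneg D)%:Z).
Proof.
move=> TK; rewrite /qdeg cardsDS //; have := subset_leq_card TK.
by move: #|circles _| #|s.2| => k l kl; congr (_ + _); lia.
Qed.

Let qdeg_arith (K K' T T' v k : nat) (w : int) : (K' + 2 * T + 1 = K + 2 * T' + 2 * k)%N ->
  K'%:Z - (2 * T')%N%:Z + (v.+1%:Z + w - 2 * (nneg D)%:Z) =
  K%:Z - (2 * T)%N%:Z + (v%:Z + w - 2 * (nneg D)%:Z) + (2 * k)%N%:Z.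
Proof. by move: (2 * (nneg D)%:Z) => u; lia. Qed.

(** At most one crossing leads from [s.1] to [s'.1], so the sum has at most one term, whose sign is
    absorbed into [m]. *)
Lemma frob_cube_power (S : comNzRingType) (g : S) (s s' : lres D) : s.2 \subset circles s.1 ->
  exists (k : nat) (m : int), frob_cube (- g) 0 s s' = g ^+ k *~ m /\
    (m != 0 -> qdeg s' = qdeg s + (2 * k)%N%:Z).
Proof.
move=> TK; have [c /andP[cv /eqP v'E]|none] :=
  pickP (fun c => (c \notin s.1) && (s'.1 == c |: s.1)); last first.
  by exists 0%N, 0; rewrite /frob_cube big_pred0 // mulr0z eqxx.
have [k [m [e me]]] := frob_edge_power g (circles s'.1) s'.2 TK.
exists k, ((-1) ^+ #|[set j in s.1 | (j < c)%N]| * m); split.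
  rewrite /frob_cube (big_pred1 c) => [|d].
    rewrite e /cube_sign; move: #|_| => p; elim: p => [|p IH]; first by rewrite !expr0 !mul1r.
    by rewrite !exprS !mulN1r !mulNr IH mulrNz.
  apply/andP/eqP => [[dv]|->]; last by rewrite cv v'E.
  by rewrite v'E => /eqP/setP/(_ d); rewrite !inE eqxx (negbTE dv) orbF => /eqP.
rewrite mulf_eq0 negb_or => /andP[_ /me[TK' ce]].
rewrite (qdegE TK) (qdegE TK') (_ : #|s'.1| = #|s.1|.+1); last by rewrite v'E cardsU1 cv.
exact: qdeg_arith ce.
Qed.

Lemma qdeg_subset (v : resolution D) (T U : labels) : T \subset U -> U \subset circles v ->
  qdeg (v, U) = qdeg (v, T) - (2 * #|U :\: T|)%N%:Z.
Proof.
move=> TU UK; rewrite !qdegE //; last exact: subset_trans UK.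
rewrite cardsDS //=; have := subset_leq_card TU; move: #|circles v| #|T| #|U| => a b c; lia.
Qed.

Lemma qdeg_base (s : lres D) : s.2 \subset circles s.1 -> base_label s ->
  qdeg (set_base s false) = qdeg s + 2.
Proof.
move=> TK bs; have bs' : base_circle s.1 \in s.2 by [].
case: s TK bs bs' => v T /= TK _ bT.
rewrite /set_base /= (qdeg_subset (subsetDl T [set base_circle v]) TK).
have -> : T :\: (T :\ base_circle v) = [set base_circle v].
  by rewrite setDDr setDv set0U; apply/setIidPr; rewrite sub1set.
by rewrite cards1 muln1 subrK.
Qed.

(** Dropping a label raises the quantum degree by 2, and the accompanying factor [d] has degree
    -2. *)
Lemma shift_homog (d : Auniv) q (F : lres D -> Auniv) :
  (forall q a, Ahomog q a -> Ahomog (q - 2) (d * a)) -> circle_supported F ->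
  (forall s, Ahomog (q - qdeg s) (F s)) -> forall s, Ahomog (q - qdeg s) (shift_labels d F s).
Proof.
move=> hd FK hF [v T]; apply: Ahomog_sum => U /= TU.
have [->|/FK UK] := eqVneq (F (v, U)) 0; first by rewrite mulr0; apply: Ahomog0.
have := Ahomog_exp hd #|U :\: T| (hF (v, U)).
by rewrite (qdeg_subset TU UK) opprB addrA addrAC addrK.
Qed.

(** The substitution Z = Y - X, followed by expanding the coefficients in A over 1 and X, which
    label the base circle. *)
Definition to_full i (z : 'cV[Auniv]_(red_rk D i)) : Cmod D i :=
  [ffun g : gen D i =>
    acoef (base_label (val g)) (shift_labels (- XA) (ext_red z) (set_base (val g) false))].

(** The substitution Y = X + Z is made at the base circle too; keeping only labellings without it
    sets Z = 0 there and so turns its variable into the scalar X. *)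
Definition to_red i (x : Cmod D i) : 'cV[Auniv]_(red_rk D i) :=
  \col_k shift_labels XA (ext_full x) (red_lab k).

Lemma shift_eq0 d i (F : lres D -> Auniv) s : (forall s, F s != 0 -> lres_at i s) ->
  ~~ lres_at i s -> shift_labels d F s = 0.
Proof.
move=> Fi si; rewrite /shift_labels big1 // => U sU.
have [->|/Fi/andP[/= UK vi]] := eqVneq (F (s.1, U)) 0; first by rewrite mulr0.
by case/negP: si; rewrite /lres_at vi (subset_trans sU UK).
Qed.

Lemma ext_red_at i (z : 'cV[Auniv]_(red_rk D i)) s : ext_red z s != 0 -> lres_at i s.
Proof. by move=> /ext_red_neq0 /andP[]. Qed.

Lemma ext_red_homog i q (z : 'cV[Auniv]_(red_rk D i)) :
  (forall k, Ahomog (q - red_sh k) (z k 0)) -> forall s, Ahomog (q - qdeg s) (ext_red z s).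
Proof. by move=> hz s; apply: Ahomog_sum => k /eqP <-; apply: hz. Qed.

Lemma ext_full_homog i q (x : Cmod D i) :
  Chomog q x -> forall s, Ahomog (q - qdeg s) (ext_full x s).
Proof. by move=> hx s; apply: Ahomog_sum => g /eqP <-; apply/Ahomog_alg/hx. Qed.

Lemma Ahomog_NXA q a : Ahomog q a -> Ahomog (q - 2) (- XA * a).
Proof. by move=> ha; rewrite mulNr; apply/AhomogN/Ahomog_XA. Qed.

Lemma to_full_homog i q (z : 'cV[Auniv]_(red_rk D i)) :
  (forall k, Ahomog (q - red_sh k) (z k 0)) -> Chomog q (to_full z).
Proof.
move=> hz g; rewrite ffunE.
have zK : circle_supported (ext_red z) by move=> s /ext_red_at /andP[].
have [h0 h1] := shift_homog Ahomog_NXA zK (ext_red_homog hz) (set_base (val g) false).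
have /andP[gK _] := valP g; case bg : (base_label (val g)).
  move: h1; rewrite (qdeg_base gK bg) => h1.
  have e (a b c : int) : a - (b + c) + c = a - b by rewrite opprD addrA subrK.
  by rewrite -(e _ _ 2); apply: h1.
have e : set_base (val g) false = val g by rewrite -[RHS]set_base_id bg.
by move: h0; rewrite e => h0; apply: h0.
Qed.

Lemma to_red_homog i q (x : Cmod D i) :
  Chomog q x -> forall k, Ahomog (q - red_sh k) (to_red x k 0).
Proof.
move=> hx k; rewrite mxE.
have xK : circle_supported (ext_full x) by move=> s /ext_full_neq0 /andP[].
exact: (shift_homog Ahomog_XA xK (ext_full_homog hx)).
Qed.

Lemma red_mx_homog i q (z : 'cV[Auniv]_(red_rk D i)) :
  (forall k, Ahomog (q - red_sh k) (z k 0)) ->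
  forall k, Ahomog (q - red_sh k) ((red_mx D i *m z) k 0).
Proof.
move=> hz k; rewrite mxE; apply: Ahomog_sum => j _; rewrite mxE.
have /andP[/andP[jK _] _] := red_labP j.
have [p [m [-> mE]]] := frob_cube_power GA (red_lab k) jK.
rewrite mulrzAl; have [->|m0] := eqVneq m 0; first by rewrite mulr0z; apply: Ahomog0.
apply: Ahomog_mulz; rewrite /red_sh (mE m0) opprD addrA.
exact: (Ahomog_exp Ahomog_GA _ (hz j)).
Qed.
End Degrees.

(** * The isomorphism of the two complexes *)

Section Equivalence.
Variables (D : gauss_code) (Dplanar : planar D).
Local Notation perm_of v := (circle_perm Dplanar v).

(** Both maps preserve evaluations, which are A-linear and jointly injective on either side;
    linearity, mutual inverseness and compatibility with the differentials all follow from this. *)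
Lemma eval_to_red i (x : Cmod D i) v phi : invariant_under (perm_of v) phi -> ~~ phi ord0 ->
  eval_at root_Z v phi (ext_red (to_red x)) = eval_at root_Y v phi (ext_full x).
Proof.
move=> inv p0; rewrite -(eval_shift _ _ _ root_YZ); apply: (eq_eval_base inv p0) => s bs.
have [/red_lab_onto[k <-]|si] := boolP (reduced_at i s); first by rewrite ext_redE mxE.
rewrite ext_red_out // (@shift_eq0 _ _ i) //; first exact: ext_full_neq0.
by apply: contra si => si; apply/andP.
Qed.

Lemma eval_to_full i (z : 'cV[Auniv]_(red_rk D i)) v phi :
  invariant_under (perm_of v) phi -> ~~ phi ord0 ->
  eval_at root_Y v phi (ext_full (to_full z)) = eval_at root_Z v phi (ext_red z).
Proof.
move=> inv p0; rewrite -(eval_merge_base _ inv p0).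
rewrite -(@eval_shift _ _ root_Z root_Y (- XA)) => [|b]; last by rewrite root_YZ addKr.
apply: eq_eval_at => s; rewrite /merge_base; case: ifP => bs.
  rewrite /shift_labels big1 // => U sU.
  have [->|/ext_red_neq0/andP[_ /negP[]]] := eqVneq (ext_red z (s.1, U)) 0; first by rewrite mulr0.
  exact: (subsetP sU).
have s0 : set_base s false = s by rewrite -[RHS]set_base_id bs.
have [si|si] := boolP (lres_at i s); last first.
  have si' : ~~ lres_at i (set_base s true).
    by apply: contra si => /(set_base_at false); rewrite set_base_set s0.
  by rewrite !ext_full_out // (@shift_eq0 _ _ i) ?mul0r ?addr0 //; apply: ext_red_at.
pose g : gen D i := Sub s si.
rewrite -[s]/(val g) -[set_base _ true]/(val (gen_base g true)) !ext_fullE !ffunE.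
rewrite [val (gen_base _ _)]/= base_label_set set_base_set /= bs s0.
by rewrite [RHS]AunivE.
Qed.

Lemma eval_full_linear i a (x y : Cmod D i) v phi :
  invariant_under (perm_of v) phi -> ~~ phi ord0 ->
  eval_at root_Y v phi (ext_full (a *: x + y)) =
  a * eval_at root_Y v phi (ext_full x) + eval_at root_Y v phi (ext_full y).
Proof.
move=> inv p0; rewrite -(eval_full_act _ _ inv p0) -[X in _ = X + _]mul1r -eval_at_linear.
by apply: eq_eval_at => s; rewrite mul1r ext_full_add.
Qed.

Lemma eval_red_linear i a (z z' : 'cV[Auniv]_(red_rk D i)) v phi :
  eval_at root_Z v phi (ext_red (a *: z + z')) =
  a * eval_at root_Z v phi (ext_red z) + eval_at root_Z v phi (ext_red z').
Proof. by rewrite -eval_at_linear; apply: eq_eval_at => s; rewrite ext_red_linear. Qed.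

Lemma to_full_linear i : linear (@to_full D i).
Proof.
move=> a z z'; apply: (eval_full_inj (Dplanar := Dplanar)) => v phi inv p0.
by rewrite eval_full_linear // !eval_to_full // eval_red_linear.
Qed.

Lemma to_red_linear i : linear (@to_red D i).
Proof.
move=> a x x'; apply: (eval_red_inj (Dplanar := Dplanar)) => v phi inv p0.
by rewrite eval_red_linear !eval_to_red // eval_full_linear.
Qed.

Lemma to_redK i : cancel (@to_red D i) (@to_full D i).
Proof.
move=> x; apply: (eval_full_inj (Dplanar := Dplanar)) => v phi inv p0.
by rewrite eval_to_full // eval_to_red.
Qed.

Lemma to_fullK i : cancel (@to_full D i) (@to_red D i).
Proof.
move=> z; apply: (eval_red_inj (Dplanar := Dplanar)) => v phi inv p0.
by rewrite eval_to_red // eval_to_full.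
Qed.

Lemma to_full_diff i (z : 'cV[Auniv]_(red_rk D i)) :
  to_full (red_mx D i *m z) = Cdiff (to_full z).
Proof.
apply: (eval_full_inj (Dplanar := Dplanar)) => v phi inv p0.
rewrite eval_to_full // (@red_mx_related D Dplanar i z v phi inv p0).
rewrite (@Cdiff_related D Dplanar i (to_full z) v phi inv p0).
apply: eq_bigr => c cv; rewrite edge_weight_YZ.
have [inv'|invF] := boolP (invariant_under (perm_of (v :\ c)) phi); first by rewrite eval_to_full.
by rewrite /edge_weight (negbTE invF) mulr0 !mul0r.
Qed.

Lemma to_red_diff i (x : Cmod D i) : to_red (Cdiff x) = red_mx D i *m to_red x.
Proof. by rewrite -[RHS]to_fullK to_full_diff to_redK. Qed.

Lemma red_mx_square0 i (z : 'cV[Auniv]_(red_rk D i)) : red_mx D (i + 1) *m (red_mx D i *m z) = 0.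
Proof.
apply: (eval_red_inj (Dplanar := Dplanar)) => v phi inv p0.
rewrite (cube_square0 (@red_mx_related D Dplanar i z) (@red_mx_related D Dplanar _ _) inv p0).
rewrite /eval_at big1 // => T _; rewrite /ext_red /extend_by0 big1 ?mul0r // => k _.
by rewrite mxE.
Qed.

End Equivalence.

(** * Chain maps and homotopies *)

Section Assembly.
Variables (D : gauss_code) (Dplanar : planar D).

Definition Cred : gcomplex := free_complex (@red_sh D) (red_mx D).

Lemma Cred_complex : is_complex Cred.
Proof.
split=> [i|i q z|i z]; [exact: linearP|exact: red_mx_homog|exact: (red_mx_square0 Dplanar)].
Qed.

Definition to_full_lin i : {linear Cred i -> Cuniv D i} :=
  HB.pack (@to_full D i : Cred i -> Cuniv D i)
    (GRing.isLinear.Build Auniv (Cred i) (Cuniv D i) *:%R (@to_full D i) (@to_full_linear D Dplanar i)).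

Definition to_red_lin i : {linear Cuniv D i -> Cred i} :=
  HB.pack (@to_red D i : Cuniv D i -> Cred i)
    (GRing.isLinear.Build Auniv (Cuniv D i) (Cred i) *:%R (@to_red D i) (@to_red_linear D Dplanar i)).

Definition to_full_map : chain_map Cred (Cuniv D) :=
  @ChainMap Cred (Cuniv D) to_full_lin (fun i q z => @to_full_homog D i q z)
    (fun i z => to_full_diff Dplanar z).

Definition to_red_map : chain_map (Cuniv D) Cred :=
  @ChainMap (Cuniv D) Cred to_red_lin (fun i q x => @to_red_homog D i q x)
    (fun i x => to_red_diff Dplanar x).

(** The chain maps are mutually inverse, so the zero homotopy suffices. *)
Lemma eq_homotopic (C : gcomplex) (f : forall i, C i -> C i) :
  (forall i q, homog C i q 0) -> (forall i, cdiff C i 0 = 0) ->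
  (forall i x, f i x = x) -> homotopic f (fun i x => x).
Proof.
move=> h0 d0 fE; exists (fun i => \0 : {linear C (i + 1) -> C i}); split=> [i q x _|i x] /=.
  exact: h0.
by rewrite fE subrr d0 addr0.
Qed.
End Assembly.

Theorem corollary1p6 (D : knot_diagram) :
  exists (rk : int -> nat) (sh : forall i, 'I_(rk i) -> int)
         (M : forall i, 'M[Auniv]_(rk (i + 1), rk i)),
    [/\ is_complex (free_complex sh M),
        forall i a b, exists (m : int) (k : nat),
          M i a b = (2 * XA - hA) ^+ k *~ m
      & homotopy_equivalent (Cuniv D) (free_complex sh M)].
Proof.
have Dplanar := code_planar D.
exists (red_rk D), (@red_sh D), (red_mx D); split; first exact: Cred_complex.
  move=> i a b; have /andP[/andP[bK _] _] := red_labP b.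
  by have [k [m [e _]]] := frob_cube_power GA (red_lab a) bK; exists m, k; rewrite mxE e.
exists (to_red_map Dplanar), (to_full_map Dplanar); split; apply: eq_homotopic.
- by move=> i q g; rewrite ffunE; apply: Rhomog0.
- by move=> i; apply/ffunP => g; rewrite !ffunE big1 // => s _; rewrite ffunE mul0r.
- by move=> i x; apply: (to_redK Dplanar).
- by move=> i q k; rewrite mxE; apply: Ahomog0.
- by move=> i; apply: mulmx0.
by move=> i x; apply: (to_fullK Dplanar).
Qed.
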